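(* For every $t\in(-1,1)$, the set $\mathrm{Hom}_0(\Gamma_{22},\mathrm{Isom}(\mathbb A\mathrm d\mathbb S^4))$ is a smooth $11$-dimensional manifold near $\rho_t$.
   Context: Let $q_{-1}(x)=-x_0^2+x_1^2+x_2^2+x_3^2-x_4^2$ on $\mathbb R^5$ with bilinear form $b_{-1}$; $\mathbb A\mathrm d\mathbb S^4=\{q_{-1}=-1\}$ and $\mathrm{Isom}(\mathbb A\mathrm d\mathbb S^4)=\mathrm O(q_{-1})$. For $q_{-1}(X)=\pm1$, $r_X\in\mathrm O(q_{-1})$ is the reflection equal to $-1$ on $X$ and to the identity on the $b_{-1}$-orthogonal of $X$; its fixed hyperplane is spacelike if $q_{-1}(X)=-1$ and timelike if $q_{-1}(X)=1$. For $\varepsilon\in\{\pm1\}^3$ put $\sigma(\varepsilon)=\varepsilon_1\varepsilon_2\varepsilon_3$. $\Gamma_{22}$ is the right-angled Coxeter group with $22$ generators $p_\varepsilon,m_\varepsilon$ ($\varepsilon\in\{\pm1\}^3$), $\ell_{k,s}$ ($k\in\{1,2,3\}$, $s\in\{\pm1\}$), each of order two, with commutation relations: $p_\varepsilon$ and $m_\delta$ commute whenever $\varepsilon,\delta$ differ in at most one coordinate; $p_\varepsilon$ and $m_\varepsilon$ commute with $\ell_{k,s}$ whenever $\varepsilon_k=s$. For $t\in(-1,1)$, $\rho_t:\Gamma_{22}\to\mathrm O(q_{-1})$ is the representation sending each generator $g$ to $r_{f_t(g)}$, where $f_t(p_\varepsilon)=(1-t^2)^{-1/2}(\sqrt2t,t\varepsilon_1,t\varepsilon_2,t\varepsilon_3,\sigma(\varepsilon))$,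 $f_t(m_\varepsilon)=(1-t^2)^{-1/2}(\sqrt2,\varepsilon_1,\varepsilon_2,\varepsilon_3,t\sigma(\varepsilon))$, $f_t(\ell_{k,s})=e_0+s\sqrt2e_k$ ($e_0,\dots,e_4$ the standard basis). $\mathrm{Hom}_{\mathrm{refl}}(\Gamma_{22},\mathrm{Isom}(\mathbb A\mathrm d\mathbb S^4))$ is the set of representations sending every generator to a reflection and sending each pair of generators appearing in a commutation relation to distinct reflections. $\mathrm{Hom}_0(\Gamma_{22},\mathrm{Isom}(\mathbb A\mathrm d\mathbb S^4))$ is the subset of those $\rho\in\mathrm{Hom}_{\mathrm{refl}}$ such that, for every pair of generators $g_1,g_2$ whose hyperplanes under $\rho_t$ are asymptotic for $t\neq0$, the hyperplanes fixed by $\rho(g_1)$ and $\rho(g_2)$ are asymptotic or equal, meaning that $|b_{-1}(X_1,X_2)|=1$ for unit normals $X_i$ with $\rho(g_i)=r_{X_i}$. Explicitly, these pairs are the following $36$: $\{p_\varepsilon,p_\delta\}$ and $\{m_\varepsilon,m_\delta\}$ with $\varepsilon,\delta$ differing in exactly one coordinate, and $\{\ell_{k,s},\ell_{k',s'}\}$ with $k\neq k'$. ''Smooth manifold near $\rho_t$'' means that some neighbourhood of $\rho_t$ in this set, as a subset of $\mathrm O(q_{-1})^{22}$, is a smooth submanifold. *)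

(* Defs.v *)
From HB Require Import structures.
From mathcomp Require Import all_boot all_order all_algebra.
From mathcomp Require Import all_classical all_reals all_analysis.

Set Implicit Arguments.
Unset Strict Implicit.
Unset Printing Implicit Defensive.

Import Order.TTheory GRing.Theory Num.Theory.
Import numFieldNormedType.Exports.

Local Open Scope classical_set_scope.
Local Open Scope ring_scope.
Local Open Scope quotient_scope.

Section RightAngledCoxeter.
Variables (T : choiceType) (comm : rel T).

(* The generators are involutions, hence no formal inverses are needed: the
   group is the quotient of the free monoid on T by the congruence generated by
   gg = 1 and, when comm g h, gh = hg. *)
Inductive racg_cong : seq T -> seq T -> Prop :=
| racg_refl u : racg_cong u u
| racg_sym u v : racg_cong u v -> racg_cong v u
| racg_trans v u w : racg_cong u v -> racg_cong v w -> racg_cong u w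
| racg_cat u u' v v' :
    racg_cong u u' -> racg_cong v v' -> racg_cong (u ++ v) (u' ++ v')
| racg_invol g : racg_cong [:: g; g] [::]
| racg_comm g h : comm g h -> racg_cong [:: g; h] [:: h; g].

Definition racg_rel : rel (seq T) := fun u v => `[< racg_cong u v >].

Lemma racg_rel_equiv : equiv_class_of racg_rel.
Proof.
split=> [u|u v|v u w].
- exact/asboolP/racg_refl.
- by apply/asboolP/asboolP; apply: racg_sym.
- by move=> /asboolP uv /asboolP vw; apply/asboolP/(racg_trans uv).
Qed.

Canonical racg_equiv := EquivRelPack racg_rel_equiv.

Definition racg : Type := {eq_quot racg_equiv}.

HB.instance Definition _ := Choice.on racg.

Definition racg_word (u : seq T) : racg := \pi_({eq_quot racg_equiv}) u.

Definition racg_repr (x : racg) : seq T := repr (x : {eq_quot racg_equiv}).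

Lemma racg_reprK : cancel racg_repr racg_word.
Proof. exact: reprK. Qed.

Lemma racg_wordP u v : racg_word u = racg_word v <-> racg_cong u v.
Proof.
by split=> [/eqmodP/asboolP|uv] //; apply/eqmodP/asboolP.
Qed.

Lemma racg_word_repr u : racg_cong (racg_repr (racg_word u)) u.
Proof. by apply/racg_wordP; rewrite racg_reprK. Qed.

Definition racg_one : racg := racg_word [::].

Definition racg_mul (x y : racg) : racg :=
  racg_word (racg_repr x ++ racg_repr y).

Definition racg_inv (x : racg) : racg := racg_word (rev (racg_repr x)).

Lemma racg_word_cat u v :
  racg_mul (racg_word u) (racg_word v) = racg_word (u ++ v).
Proof. by apply/racg_wordP/racg_cat; apply: racg_word_repr. Qed.

Lemma racg_rev u v : racg_cong u v -> racg_cong (rev u) (rev v).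
Proof.
elim=> {u v} [u|u v _|v u w _ uv _|u u' v v' _ uu' _ vv'|g|g h gh].
- exact: racg_refl.
- exact: racg_sym.
- exact: racg_trans uv.
- by rewrite !rev_cat; apply: racg_cat.
- exact: racg_invol.
- exact/racg_sym/racg_comm.
Qed.

Lemma racg_catV u : racg_cong (u ++ rev u) [::].
Proof.
elim: u => [|g u IHu]; first exact: racg_refl.
rewrite rev_cons -cats1 -[g :: u]cat1s -catA (catA u).
apply: racg_trans (racg_invol g); rewrite -[[:: g; g]]/([:: g] ++ [::] ++ [:: g]).
by apply/racg_cat/racg_cat => //; apply: racg_refl.
Qed.

Lemma racg_mulA : associative racg_mul.
Proof.
move=> x y z; rewrite -(racg_reprK x) -(racg_reprK y) -(racg_reprK z).
by rewrite !racg_word_cat catA.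
Qed.

Lemma racg_mul1 : left_id racg_one racg_mul.
Proof. by move=> x; rewrite -(racg_reprK x) racg_word_cat. Qed.

Lemma racg_mulr1 : right_id racg_one racg_mul.
Proof. by move=> x; rewrite -(racg_reprK x) racg_word_cat cats0. Qed.

Lemma racg_mulrV : right_inverse racg_one racg_inv racg_mul.
Proof.
move=> x; rewrite /racg_inv -[x in X in racg_mul X]racg_reprK racg_word_cat.
exact/racg_wordP/racg_catV.
Qed.

Lemma racg_mulV : left_inverse racg_one racg_inv racg_mul.
Proof.
move=> x; rewrite /racg_inv -[x in X in racg_mul _ X]racg_reprK racg_word_cat.
apply/racg_wordP; rewrite -[X in _ ++ X]revK; exact: racg_catV.
Qed.

HB.instance Definition _ := isGroup.Build racg
  racg_mulA racg_mul1 racg_mulr1 racg_mulV racg_mulrV.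

Definition racg_gen (g : T) : racg := racg_word [:: g].

Section Lift.
Variables (A : pzRingType) (r : T -> A).

Definition racg_lift (x : racg) : A := \prod_(g <- racg_repr x) r g.

Hypotheses (r2 : forall g, r g * r g = 1)
  (rC : forall g h, comm g h -> r g * r h = r h * r g).

Lemma racg_lift_word u : racg_lift (racg_word u) = \prod_(g <- u) r g.
Proof.
rewrite /racg_lift; have := racg_word_repr u; move: (racg_repr _) => v.
elim=> {u v} //.
- by move=> v u w _ -> _ ->.
- by move=> u u' v v' _ uu' _ vv'; rewrite !big_cat uu' vv'.
- by move=> g; rewrite !big_cons !big_nil mulr1 r2.
- by move=> g h gh; rewrite !big_cons !big_nil !mulr1 rC.
Qed.

Lemma racg_lift_gen g : racg_lift (racg_gen g) = r g.
Proof. by rewrite racg_lift_word big_seq1. Qed.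

Lemma racg_lift1 : racg_lift 1%g = 1.
Proof. by rewrite racg_lift_word big_nil. Qed.

Lemma racg_liftM x y : racg_lift (x * y)%g = racg_lift x * racg_lift y.
Proof. by rewrite racg_lift_word big_cat. Qed.

End Lift.

End RightAngledCoxeter.

(* The boolean b encodes the sign (-1) ^ b. *)
Definition signs : Type := {ffun 'I_3 -> bool}.
HB.instance Definition _ := Finite.on signs.

Definition ndiff (e d : signs) : nat := #|[pred k | e k != d k]|.

Inductive gen : Type :=
| gen_p of signs
| gen_m of signs
| gen_l of 'I_3 & bool.

Definition gen_code (g : gen) : signs + signs + 'I_3 * bool :=
  match g with
  | gen_p e => inl (inl e)
  | gen_m e => inl (inr e)
  | gen_l k s => inr (k, s)
  end.

Definition gen_decode (c : signs + signs + 'I_3 * bool) : gen :=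
  match c with
  | inl (inl e) => gen_p e
  | inl (inr e) => gen_m e
  | inr (k, s) => gen_l k s
  end.

Lemma gen_codeK : cancel gen_code gen_decode.
Proof. by case. Qed.

HB.instance Definition _ := Finite.copy gen (can_type gen_codeK).

Lemma card_gen : #|{: gen}| = 22%N.
Proof.
have decodeK : cancel gen_decode gen_code by case=> [[]|[]].
rewrite (bij_eq_card (Bijective gen_codeK decodeK)).
by rewrite !card_sum card_prod !card_ffun !card_ord !card_bool.
Qed.

Definition gen_comm (g h : gen) : bool :=
  match g, h with
  | gen_p e, gen_m d | gen_m d, gen_p e => (ndiff e d <= 1)%N
  | gen_p e, gen_l k s | gen_l k s, gen_p e
  | gen_m e, gen_l k s | gen_l k s, gen_m e => e k == s
  | _, _ => false
  end.

(* The pairs whose hyperplanes under rho_t are asymptotic for t != 0. *)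
Definition gen_asym (g h : gen) : bool :=
  match g, h with
  | gen_p e, gen_p d | gen_m e, gen_m d => ndiff e d == 1%N
  | gen_l k _, gen_l k' _ => k != k'
  | _, _ => false
  end.

Definition Gamma22 : Type := racg gen_comm.
HB.instance Definition _ := Group.on Gamma22.

Definition gamma (g : gen) : Gamma22 := racg_gen gen_comm g.

Section AdS4.
Variable R : realType.

Definition ads_sign (i : 'I_5) : R :=
  if ((i : nat) == 0%N) || ((i : nat) == 4%N) then -1 else 1.

Definition ads_b (x y : 'cV[R]_5) : R := \sum_i ads_sign i * x i 0 * y i 0.

Definition ads_q (x : 'cV[R]_5) : R := ads_b x x.

Definition isom_ads4 : set 'M[R]_5 :=
  [set A | forall x : 'cV[R]_5, ads_q (A *m x) = ads_q x].

Definition unit_normal (X : 'cV[R]_5) : Prop := ads_q X = 1 \/ ads_q X = -1.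

(* The matrix of v |-> v - 2 b(v, X) / q(X) X. *)
Definition ads_refl (X : 'cV[R]_5) : 'M[R]_5 :=
  \matrix_(i, j) ((i == j)%:R - 2 / ads_q X * X i 0 * (ads_sign j * X j 0)).

Lemma ads_refl_mul (X v : 'cV[R]_5) :
  ads_refl X *m v = v - (2 / ads_q X * ads_b v X) *: X.
Proof.
apply/matrixP => i j; rewrite !mxE ord1 {j}.
under eq_bigr do rewrite mxE mulrBl.
rewrite sumrB (bigD1 i) //= eqxx mul1r big1 ?addr0; last first.
  by move=> k /negPf; rewrite eq_sym => ->; rewrite mul0r.
congr (_ - _); rewrite /ads_b mulr_sumr mulr_suml; apply: eq_bigr => k _.
by rewrite -!mulrA; congr (_ * (_ * _)); rewrite mulrC -!mulrA; congr (_ * _);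
   rewrite mulrCA mulrC -mulrA mulrCA.
Qed.

Lemma ads_reflN (X : 'cV[R]_5) : unit_normal X -> ads_refl X *m X = - X.
Proof.
move=> uX; have qX : ads_q X != 0.
  by case: uX => ->; rewrite ?oppr_eq0 oner_eq0.
rewrite ads_refl_mul -/(ads_q X) divfK // scaler_nat mulr2n opprD addrA subrr.
by rewrite sub0r.
Qed.

Lemma ads_refl_orth (X v : 'cV[R]_5) : ads_b v X = 0 -> ads_refl X *m v = v.
Proof. by move=> vX; rewrite ads_refl_mul vX mulr0 scale0r subr0. Qed.

Definition is_representation (rho : Gamma22 -> 'M[R]_5) : Prop :=
  [/\ forall x, isom_ads4 (rho x),
      rho 1%g = 1%:M &
      forall x y, rho (x * y)%g = rho x *m rho y].

Definition Hom_refl : set (Gamma22 -> 'M[R]_5) :=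
  [set rho | [/\ is_representation rho,
    (forall g, exists2 X, unit_normal X & rho (gamma g) = ads_refl X) &
    forall g h, gen_comm g h -> rho (gamma g) <> rho (gamma h)]].

Definition Hom_0 : set (Gamma22 -> 'M[R]_5) :=
  [set rho | Hom_refl rho /\
    forall g h, gen_asym g h -> forall X Y, unit_normal X -> unit_normal Y ->
      rho (gamma g) = ads_refl X -> rho (gamma h) = ads_refl Y ->
      `|ads_b X Y| = 1].

(* The embedding of Hom into O(q)^22, viewed inside 'M_5^22: the row of index i
   lists the entries of the image of the i-th generator. As O(q)^22 is a closed
   submanifold of 'M_5^22, the two ambient spaces give the same submanifolds. *)
Definition on_gens (rho : Gamma22 -> 'M[R]_5) : 'M[R]_(#|{: gen}|, 5 * 5) :=
  \matrix_(i, j) mxvec (rho (gamma (enum_val i))) 0 j.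

Definition sg (b : bool) : R := (-1) ^+ b.

Definition sigma (e : signs) : R := \prod_k sg (e k).

Definition vec5 (x0 x1 x2 x3 x4 : R) : 'cV[R]_5 :=
  \col_i [:: x0; x1; x2; x3; x4]`_i.

Definition fvec (t : R) (g : gen) : 'cV[R]_5 :=
  match g with
  | gen_p e => (Num.sqrt (1 - t ^+ 2))^-1 *:
      vec5 (Num.sqrt 2 * t) (t * sg (e 0)) (t * sg (e 1)) (t * sg (e 2))
           (sigma e)
  | gen_m e => (Num.sqrt (1 - t ^+ 2))^-1 *:
      vec5 (Num.sqrt 2) (sg (e 0)) (sg (e 1)) (sg (e 2)) (t * sigma e)
  | gen_l k s =>
      delta_mx ord0 0 + (sg s * Num.sqrt 2) *: delta_mx (inord k.+1) 0
  end.

Definition rho_t (t : R) : Gamma22 -> 'M[R]_5 :=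
  racg_lift (fun g => ads_refl (fvec t g)).

End AdS4.

Section Submanifolds.
Variable R : realType.

(* C^k maps on an open set U; V and W are meant to be finite-dimensional. *)
Fixpoint Ck (V W : normedModType R) (k : nat) (U : set V) (f : V -> W) : Prop :=
  match k with
  | 0 => forall x, U x -> {for x, continuous f}
  | k'.+1 => (forall x, U x -> differentiable f x) /\
             (forall v, Ck k' U ('D_v f))
  end.

Definition smooth (V W : normedModType R) (U : set V) (f : V -> W) : Prop :=
  forall k, Ck k U f.

(* Smooth maps on arbitrary subsets, diffeomorphisms between subsets, and
   submanifolds are those of Milnor, Topology from the Differentiable
   Viewpoint, and Guillemin-Pollack: a subset is a d-dimensional submanifold
   when it is locally diffeomorphic to open subsets of R^d. *)
Definition smooth_on (V W : normedModType R) (A : set V) (f : V -> W) : Prop :=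
  forall x, A x -> exists (U : set V) (F : V -> W),
    [/\ open U, U x, smooth U F & forall y, A y -> U y -> F y = f y].

Definition diffeomorphic (V W : normedModType R) (A : set V) (B : set W) :
    Prop :=
  exists (f : V -> W) (g : W -> V),
    [/\ smooth_on A f, smooth_on B g,
        forall x, A x -> B (f x) /\ g (f x) = x &
        forall y, B y -> A (g y) /\ f (g y) = y].

Definition submanifold (V : normedModType R) (d : nat) (M : set V) : Prop :=
  forall x, M x -> exists (O : set V) (U : set 'rV[R]_d),
    [/\ open O, O x, open U & diffeomorphic U (M `&` O)].

Definition smooth_manifold_near (V : normedModType R) (d : nat) (S : set V)
    (x : V) : Prop :=
  S x /\ exists O : set V, [/\ open O, O x & submanifold d (S `&` O)].

End Submanifolds.

(* Main.v *)
(* Let X_g be unit normals of the reflections rho(g).  At a vertex eps of the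
   cube, the normals of the three walls l_{k,eps_k} and of p_eps, m_eps form a
   basis of R^5 with a fixed nondegenerate Gram matrix.  If delta is obtained from
   eps by flipping the coordinate k, and {i, j, k} = {1, 2, 3}, the relations force
     X(p_delta) = - X(p_eps) - b(X(p_eps), X(l_{k,delta_k})) / 2 * n,
   where n = X(l_{i,eps_i}) + X(l_{j,eps_j}) is a null vector, and likewise for m.
   Flipping two coordinates in either order and comparing gives
   b(X(l_{k,+}), X(l_{k,-})) = -3 for all k, and then the products
   y = b(X(p_{+++}), X(l_{k,-})), z = b(X(m_{+++}), X(l_{k,-})) do not depend on k
   and satisfy z^2 - y^2 = 8.  So near rho_t a representation in Hom_0 is
   determined by the frame at +++, that is an element of O(q) near the identity
   (10 parameters, through the Cayley transform), and by u = y / z in (-1, 1): it is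
   the conjugate of rho_u by that element. *)
Require Import Defs.
From mathcomp Require Import all_boot all_order all_algebra.
From mathcomp Require Import all_classical all_reals all_analysis.
From mathcomp Require Import ring lra.

Set Implicit Arguments.
Unset Strict Implicit.
Unset Printing Implicit Defensive.

Import Order.TTheory GRing.Theory Num.Theory.
Import numFieldNormedType.Exports.
Local Open Scope classical_set_scope.
Local Open Scope ring_scope.

(** * Smooth maps *)

Section Smoothness.
Context {R : realType} {V : normedModType R}.
Implicit Types (U : set V) (k : nat).

(** The first-order expansion of [f] at [a] is also one of [g], with the same linear part;
    [diff_unique] identifies that part with the differential of [g]. *)
Lemma near_eq_differentiable (W : normedModType R) (f g : V -> W) (a : V) :
  (\near a, f a = g a) -> differentiable f a -> differentiable g a.
Proof.
move=> fg df; have fga := nbhs_singleton fg.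
have ga : g \o shift a = cst (g a) + 'd f a +o_ 0 id.
  apply/eqaddoP => e e0; have /eqaddoP/(_ e e0) := diff_locally df.
  move: fg; rewrite (near_shift 0 a) subr0 => fg; move: fg.
  apply: filterS2 => h /= fgh; rewrite !fctE /= -fga.
  by rewrite fgh.
have dg := diff_unique (diff_continuous df) ga.
by apply/diff_locallyP; rewrite dg; split=> //; exact: diff_continuous.
Qed.

Lemma open_near_eq (W : Type) U (f g : V -> W) (x : V) :
  open U -> U x -> (forall y, U y -> f y = g y) -> \near x, f x = g x.
Proof. by move=> oU Ux fg; near=> y; apply: fg; near: y; exact: open_nbhs_nbhs.
Unshelve. all: by end_near. Qed.

(** The derivatives in [Ck] are taken in the whole space, so agreement on [U] passes to them because
    [U] is open: the functions agree near each of its points. *)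
Lemma Ck_eq (W : normedModType R) k U (f g : V -> W) :
  open U -> (forall x, U x -> f x = g x) -> Ck k U f -> Ck k U g.
Proof.
move=> oU; elim: k f g => [|k IHk] f g fg /=.
  move=> cf x Ux; have fx : f @ x --> g x by rewrite -fg //; exact: cf.
  apply: cvg_trans fx; apply: near_eq_cvg; exact: open_near_eq oU Ux fg.
move=> [df dfk]; split=> [x Ux|v].
  exact: near_eq_differentiable (open_near_eq oU Ux fg) (df x Ux).
apply: IHk (dfk v) => x Ux.
exact: near_eq_derive (open_near_eq oU Ux fg).
Qed.

Lemma CkW (W : normedModType R) k U (f : V -> W) : Ck k.+1 U f -> Ck k U f.
Proof.
elim: k f => [|k IHk] f /= [df dfk].
  by move=> x Ux; apply: differentiable_continuous; apply: df.
by split=> // v; apply: IHk.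
Qed.

Lemma Ck_cst (W : normedModType R) k U (c : W) : Ck k U (fun=> c).
Proof.
elim: k c => [|k IHk] c /=; first by move=> x _; exact: cst_continuous.
split=> [x _|v]; first exact: differentiable_cst.
rewrite (_ : 'D_v _ = fun=> 0); first exact: IHk.
by apply/funext => x; rewrite derive_cst.
Qed.

Lemma CkD (W : normedModType R) k U (f g : V -> W) :
  open U -> Ck k U f -> Ck k U g -> Ck k U (fun x => f x + g x).
Proof.
move=> oU; elim: k f g => [|k IHk] f g /=.
  by move=> cf cg x Ux; apply: continuousD; [exact: cf|exact: cg].
move=> [df dfk] [dg dgk]; split=> [x Ux|v].
  by apply: differentiableD; [exact: df|exact: dg].
apply: Ck_eq (IHk _ _ (dfk v) (dgk v)) => // x Ux.
by rewrite -deriveD //; apply: diff_derivable; [exact: df|exact: dg].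
Qed.

(** The Leibniz rule involves [f] and [g] themselves, which [CkW] provides at order [k]. *)
Lemma CkM k U (f g : V -> R) :
  open U -> Ck k U f -> Ck k U g -> Ck k U (fun x => f x * g x).
Proof.
move=> oU; elim: k f g => [|k IHk] f g.
  by move=> cf cg x Ux; apply: continuousM; [exact: cf|exact: cg].
move=> Cf Cg; have [df dfk] := Cf; have [dg dgk] := Cg; split=> [x Ux|v].
  by apply: differentiableM; [exact: df|exact: dg].
apply: Ck_eq (CkD oU (IHk _ _ (CkW Cf) (dgk v))
                         (IHk _ _ (CkW Cg) (dfk v))) => // x Ux.
by rewrite deriveM //; apply: diff_derivable; [exact: df|exact: dg].
Qed.

(** The derivative is -f'/f^2, a product of f' and two copies of the inverse, to which the induction
    hypothesis applies. *)
Lemma CkV k U (f : V -> R) : open U -> (forall x, U x -> f x != 0) ->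
  Ck k U f -> Ck k U (fun x => (f x)^-1).
Proof.
move=> oU f0; elim: k f f0 => [|k IHk] f f0.
  by move=> cf x Ux; apply: continuousV; [exact: f0|exact: cf].
move=> Cf; have [df dfk] := Cf; split=> [x Ux|v].
  by apply: differentiableV; [exact: df|exact: f0].
have CV := IHk _ f0 (CkW Cf).
apply: Ck_eq (CkM oU (CkM oU (Ck_cst k U (-1 : R))
  (CkM oU CV CV)) (dfk v)) => // x Ux.
rewrite deriveV ?f0 //; last by apply: diff_derivable; exact: df.
by rewrite mulN1r -expr2 -exprVn.
Qed.

Lemma CkZl (W : normedModType R) k U (f : V -> R) (w : W) :
  open U -> Ck k U f -> Ck k U (fun x => f x *: w).
Proof.
move=> oU; elim: k f => [|k IHk] f.
  by move=> cf x Ux; apply: cvgZr_tmp; exact: cf.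
move=> [df dfk]; split=> [x Ux|v].
  by apply: differentiableZl; exact: df.
apply: Ck_eq (IHk _ (dfk v)) => // x Ux.
have dfx := df x Ux.
by rewrite !deriveE ?diffZl //; exact: differentiableZl.
Qed.

Lemma differentiable_sqrt (x : R) : 0 < x -> differentiable (@Num.sqrt R) x.
Proof.
by move=> x0; apply/derivable1_diffP; have [] := is_derive1_sqrt x0.
Qed.

(** The derivative f'/(2 sqrt f) contains the root again, one order lower, which closes the
    induction. *)
Lemma Ck_sqrt k U (f : V -> R) : open U -> (forall x, U x -> 0 < f x) ->
  Ck k U f -> Ck k U (fun x => Num.sqrt (f x)).
Proof.
move=> oU f0; elim: k f f0 => [|k IHk] f f0.
  move=> cf x Ux; apply: (@continuous_comp _ _ _ f) (cf x Ux) _.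
  exact: sqrt_continuous.
move=> Cf; have [df dfk] := Cf.
have dsf x : U x -> differentiable (fun x => Num.sqrt (f x)) x.
  move=> Ux; apply: (@differentiable_comp _ _ _ _ f) (df x Ux) _.
  exact/differentiable_sqrt/f0.
split=> // v.
have CS := IHk _ f0 (CkW Cf).
have C2S := CkM oU (Ck_cst k U (2 : R)) CS.
have S0 x : U x -> 2 * Num.sqrt (f x) != 0.
  by move=> Ux; rewrite mulf_neq0 ?pnatr_eq0 // gt_eqF // sqrtr_gt0 f0.
apply: Ck_eq (CkM oU (CkV oU S0 C2S) (dfk v)) => // x Ux.
have dfx := df x Ux; have dsx := differentiable_sqrt (f0 x Ux).
rewrite [RHS]deriveE; last exact: dsf.
rewrite [in RHS](_ : (fun x => _) = @Num.sqrt R \o f) // diff_comp //=.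
rewrite deriveE // mulrC; set y := 'd f x v.
by rewrite -[in RHS](mulr1 y) [RHS]linearZ /= -deriveE // derive_sqrt ?f0.
Qed.

Lemma smooth_eq (W : normedModType R) U (f g : V -> W) :
  open U -> (forall x, U x -> f x = g x) -> smooth U f -> smooth U g.
Proof. by move=> oU fg Cf k; apply: Ck_eq fg (Cf k). Qed.

Lemma smooth_continuous (W : normedModType R) U (f : V -> W) (x : V) :
  smooth U f -> U x -> {for x, continuous f}.
Proof. by move=> /(_ 0%N) /= /[apply]. Qed.

Lemma smooth_cst (W : normedModType R) U (c : W) : smooth U (fun=> c).
Proof. by move=> k; exact: Ck_cst. Qed.

Lemma smoothD (W : normedModType R) U (f g : V -> W) :
  open U -> smooth U f -> smooth U g -> smooth U (fun x => f x + g x).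
Proof. by move=> oU Cf Cg k; exact: CkD. Qed.

Lemma smoothM U (f g : V -> R) :
  open U -> smooth U f -> smooth U g -> smooth U (fun x => f x * g x).
Proof. by move=> oU Cf Cg k; exact: CkM. Qed.

Lemma smoothV U (f : V -> R) : open U -> (forall x, U x -> f x != 0) ->
  smooth U f -> smooth U (fun x => (f x)^-1).
Proof. by move=> oU f0 Cf k; exact: CkV. Qed.

Lemma smooth_sqrt U (f : V -> R) : open U -> (forall x, U x -> 0 < f x) ->
  smooth U f -> smooth U (fun x => Num.sqrt (f x)).
Proof. by move=> oU f0 Cf k; exact: Ck_sqrt. Qed.

Lemma smoothN U (f : V -> R) :
  open U -> smooth U f -> smooth U (fun x => - f x).
Proof.
move=> oU Cf; apply: smooth_eq (smoothM oU (smooth_cst _ (-1 : R)) Cf) => //.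
by move=> x _; rewrite mulN1r.
Qed.

Lemma smoothB U (f g : V -> R) :
  open U -> smooth U f -> smooth U g -> smooth U (fun x => f x - g x).
Proof. by move=> oU Cf Cg; apply: smoothD => //; exact: smoothN. Qed.

Lemma smooth_sum (W : normedModType R) (I : Type) (r : seq I) (P : pred I) U
    (F : I -> V -> W) : open U -> (forall i, smooth U (F i)) ->
  smooth U (fun x => \sum_(i <- r | P i) F i x).
Proof.
move=> oU CF; elim: r => [|i r IHr].
  by apply: smooth_eq (smooth_cst _ 0) => // x _; rewrite big_nil.
case Pi: (P i); last first.
  by apply: smooth_eq IHr => // x _; rewrite big_cons Pi.
by apply: smooth_eq (smoothD oU (CF i) IHr) => // x _; rewrite big_cons Pi.
Qed.

Lemma smooth_prod (I : Type) (r : seq I) (P : pred I) U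
    (F : I -> V -> R) : open U -> (forall i, smooth U (F i)) ->
  smooth U (fun x => \prod_(i <- r | P i) F i x).
Proof.
move=> oU CF; elim: r => [|i r IHr].
  by apply: smooth_eq (smooth_cst _ (1 : R)) => // x _; rewrite big_nil.
case Pi: (P i); last first.
  by apply: smooth_eq IHr => // x _; rewrite big_cons Pi.
apply: (@smooth_eq _ _ (fun x => F i x * \prod_(i <- r | P i) F i x)) => //.
  by move=> x _; rewrite big_cons Pi.
exact: smoothM oU (CF i) IHr.
Qed.

(** Entrywise smoothness reduces products, determinants and inverses of matrices to scalar
    operations; [smooth_mxP] returns to the normed space of matrices. *)
Definition smooth_mx m n U (F : V -> 'M[R]_(m, n)) :=
  forall i j, smooth U (fun x => F x i j).

Lemma smooth_mxP m n U (F : V -> 'M[R]_(m, n)) :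
  open U -> smooth_mx U F -> smooth U F.
Proof.
move=> oU CF.
apply: (@smooth_eq _ _ (fun x => \sum_i \sum_j F x i j *: delta_mx i j)) => //.
  by move=> x _; rewrite -matrix_sum_delta.
by do 2!apply: smooth_sum => // ?; move=> k; apply: CkZl => //; apply: CF.
Qed.

Lemma smooth_mx_cst m n U (A : 'M[R]_(m, n)) : smooth_mx U (fun=> A).
Proof. by move=> i j; exact: smooth_cst. Qed.

Lemma smooth_mxD m n U (F G : V -> 'M[R]_(m, n)) : open U ->
  smooth_mx U F -> smooth_mx U G ->
  smooth_mx U (fun x => F x + G x).
Proof.
move=> oU CF CG i j.
apply: (@smooth_eq _ _ (fun x => F x i j + G x i j)) => //; last exact: smoothD.
by move=> x _; rewrite mxE.
Qed.

Lemma smooth_mxZ m n U (f : V -> R) (G : V -> 'M[R]_(m, n)) : open U ->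
  smooth U f -> smooth_mx U G ->
  smooth_mx U (fun x => f x *: G x).
Proof.
move=> oU CF CG i j.
apply: (@smooth_eq _ _ (fun x => f x * G x i j)) => //; last exact: smoothM.
by move=> x _; rewrite mxE.
Qed.

Lemma smooth_mxB m n U (F G : V -> 'M[R]_(m, n)) : open U ->
  smooth_mx U F -> smooth_mx U G ->
  smooth_mx U (fun x => F x - G x).
Proof.
move=> oU CF CG i j.
apply: (@smooth_eq _ _ (fun x => F x i j - G x i j)) => //; last exact: smoothB.
by move=> x _; rewrite !mxE.
Qed.

Lemma smooth_mulmx m n p U (F : V -> 'M[R]_(m, n)) (G : V -> 'M[R]_(n, p)) :
  open U -> smooth_mx U F -> smooth_mx U G ->
  smooth_mx U (fun x => F x *m G x).
Proof.
move=> oU CF CG i j.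
apply: (@smooth_eq _ _ (fun x => \sum_k F x i k * G x k j)) => //.
  by move=> x _; rewrite mxE.
by apply: smooth_sum => // k; apply: smoothM.
Qed.

Lemma smooth_trmx m n U (F : V -> 'M[R]_(m, n)) : open U ->
  smooth_mx U F -> smooth_mx U (fun x => (F x)^T).
Proof.
by move=> oU CF i j; apply: smooth_eq (CF j i) => // x _; rewrite mxE.
Qed.

Lemma smooth_det n U (F : V -> 'M[R]_n) : open U ->
  smooth_mx U F -> smooth U (fun x => \det (F x)).
Proof.
move=> oU CF; apply: smooth_sum => // s; apply: smoothM => //.
  exact: smooth_cst.
exact: smooth_prod.
Qed.

(** Cramer's rule: the entries of the inverse are cofactors divided by the determinant. *)
Lemma smooth_invmx n U (F : V -> 'M[R]_n) : open U ->
  (forall x, U x -> \det (F x) != 0) ->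
  smooth_mx U F -> smooth_mx U (fun x => invmx (F x)).
Proof.
move=> oU F0 CF i j.
apply: (@smooth_eq _ _ (fun x => (\det (F x))^-1 * cofactor (F x) j i)) => //.
  by move=> x Ux; rewrite /invmx unitmxE unitfE F0 // !mxE.
apply: smoothM => //; first by apply: smoothV => //; exact: smooth_det.
apply: smoothM; [by []|exact: smooth_cst|].
apply: smooth_det => // k l; apply: smooth_eq (CF (lift j k) (lift i l)) => //.
by move=> x _; rewrite !mxE.
Qed.

End Smoothness.

Section Coordinates.
Context {R : realType}.

(** A coordinate is linear, so its directional derivatives are constant and [Ck_cst] settles all
    higher orders at once. *)
Lemma smooth_coord m n (U : set 'M[R]_(m, n)) i j :
  open U -> smooth U (fun A : 'M[R]_(m, n) => A i j).
Proof.
move=> oU [|k] /=; first by move=> A _; exact: coord_continuous.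
split=> [A _|v]; first exact: differentiable_coord.
apply: (@Ck_eq _ _ _ _ _ (fun=> v i j)) (Ck_cst _ _ _) => // A _.
apply/esym; rewrite /derive; apply: lim_near_cst; first exact: Rhausdorff.
near=> h; rewrite /= !mxE addrK /GRing.scale /= mulKf //.
by near: h; exact: nbhs_dnbhs_neq.
Unshelve. all: by end_near. Qed.

Lemma open_preimage (V W : normedModType R) (U : set V) (f : V -> W)
    (D : set W) :
  open U -> smooth U f -> open D -> open (U `&` f @^-1` D).
Proof.
move=> oU Cf oD; rewrite openE => x [Ux Dfx]; apply: filterI.
  exact: open_nbhs_nbhs.
by apply: (smooth_continuous Cf Ux); exact: open_nbhs_nbhs.
Qed.

End Coordinates.

(** * The form and its reflections *)

Section BilinearForm.
Context {R : realType}.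
Implicit Types (x y z X Y : 'cV[R]_5) (A : 'M[R]_5).

Lemma ads_bC x y : ads_b x y = ads_b y x.
Proof. by apply: eq_bigr => i _; rewrite mulrAC. Qed.

Lemma ads_bDl x y z : ads_b (x + y) z = ads_b x z + ads_b y z.
Proof. by rewrite -big_split; apply: eq_bigr => i _; rewrite /= mxE; ring. Qed.

Lemma ads_bZl (a : R) x y : ads_b (a *: x) y = a * ads_b x y.
Proof. by rewrite mulr_sumr; apply: eq_bigr => i _; rewrite /= mxE; ring. Qed.

Lemma ads_bDr x y z : ads_b x (y + z) = ads_b x y + ads_b x z.
Proof. by rewrite ads_bC ads_bDl ![ads_b _ x]ads_bC. Qed.

Lemma ads_bZr (a : R) x y : ads_b x (a *: y) = a * ads_b x y.
Proof. by rewrite ads_bC ads_bZl ads_bC. Qed.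

Lemma ads_bNl x y : ads_b (- x) y = - ads_b x y.
Proof. by rewrite -scaleN1r ads_bZl mulN1r. Qed.

Lemma ads_bNr x y : ads_b x (- y) = - ads_b x y.
Proof. by rewrite ads_bC ads_bNl ads_bC. Qed.

Definition ads_b_lin := (ads_bDl, ads_bDr, ads_bZl, ads_bZr, ads_bNl, ads_bNr).

Lemma ads_qZ (a : R) x : ads_q (a *: x) = a ^+ 2 * ads_q x.
Proof. by rewrite /ads_q !ads_b_lin; ring. Qed.

Definition ads_J : 'M[R]_5 := diag_mx (\row_i ads_sign R i).

Lemma ads_sign2 i : ads_sign R i * ads_sign R i = 1.
Proof. by rewrite /ads_sign; case: ifP => _; ring. Qed.

Lemma ads_JJ : ads_J *m ads_J = 1%:M.
Proof.
apply/matrixP => i j; rewrite mul_diag_mx !mxE.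
by case: eqP => [->|_]; rewrite ?ads_sign2 // mulr0n mulr0.
Qed.

Lemma tr_ads_J : ads_J^T = ads_J.
Proof. exact: tr_diag_mx. Qed.

Lemma ads_bE x y : ads_b x y = (x^T *m ads_J *m y) 0 0.
Proof.
rewrite mxE; apply: eq_bigr => i _; rewrite mul_mx_diag !mxE.
by rewrite (mulrC (x i 0)).
Qed.

Lemma gram_mxE m n (F : 'M[R]_(5, m)) (H : 'M[R]_(5, n)) i j :
  (F^T *m ads_J *m H) i j = ads_b (col i F) (col j H).
Proof.
rewrite ads_bE tr_col -row_mul [RHS]mxE [LHS]mxE.
by apply: eq_bigr => k _; rewrite [in RHS]mxE [col j H k 0]mxE.
Qed.

Definition ads_isometry A : Prop := A^T *m ads_J *m A = ads_J.

Lemma ads_isometry_b A x y : ads_isometry A ->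
  ads_b (A *m x) (A *m y) = ads_b x y.
Proof.
by move=> iA; rewrite !ads_bE trmx_mul -!mulmxA (mulmxA ads_J) (mulmxA A^T)
  (mulmxA A^T) iA.
Qed.

Lemma mulmx_ext n (A B : 'M[R]_n) :
  (forall x : 'cV[R]_n, A *m x = B *m x) -> A = B.
Proof.
move=> AB; apply/matrixP => i j; have /matrixP/(_ i 0) := AB (delta_mx j 0).
by rewrite -!colE !mxE.
Qed.

Lemma unit_normal_neq0 X : unit_normal X -> ads_q X != 0.
Proof. by case=> ->; rewrite ?oppr_eq0 oner_eq0. Qed.

Lemma ads_refl_isom X : unit_normal X -> isom_ads4 (ads_refl X).
Proof.
move=> /unit_normal_neq0 qX v; rewrite ads_refl_mul /ads_q !ads_b_lin.
rewrite -!/(ads_q _) (ads_bC X v); field; exact: qX.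
Qed.

Lemma ads_refl_invol X : unit_normal X -> ads_refl X *m ads_refl X = 1%:M.
Proof.
move=> uX; have qX := unit_normal_neq0 uX; apply: mulmx_ext => v.
rewrite mul1mx -mulmxA [ads_refl X *m v]ads_refl_mul mulmxBr -scalemxAr.
by rewrite ads_reflN // ads_refl_mul scalerN opprK subrK.
Qed.

Lemma ads_refl_comm X Y : ads_b X Y = 0 ->
  ads_refl X *m ads_refl Y = ads_refl Y *m ads_refl X.
Proof.
move=> XY; apply: mulmx_ext => v; rewrite -!mulmxA !ads_refl_mul.
by rewrite !ads_b_lin XY (ads_bC Y) XY !mulr0 !oppr0 !addr0 addrAC.
Qed.

Lemma ads_reflZ (a : R) X : a != 0 -> ads_refl (a *: X) = ads_refl X.
Proof.
move=> a0; have [q0|q0] := eqVneq (ads_q X) 0.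
  by apply/matrixP => i j; rewrite !mxE ads_qZ q0 mulr0 invr0 mulr0 !mul0r.
apply/matrixP => i j; rewrite !mxE ads_qZ; congr (_ - _); field.
by rewrite a0 q0.
Qed.

(** [X] is negated by [ads_refl Y], hence lies on the line of [Y]. Both norms are 1 or -1 and the
    squared ratio is nonnegative, so it is 1. *)
Lemma ads_refl_eqP X Y : unit_normal X -> unit_normal Y ->
  ads_refl X = ads_refl Y -> exists2 a : R, a ^+ 2 = 1 & X = a *: Y.
Proof.
move=> uX uY XY; have := ads_reflN uX; rewrite XY ads_refl_mul => /eqP.
rewrite subr_eq addrC -subr_eq opprK -mulr2n -scaler_nat => /eqP eX.
have {}eX : X = (ads_b X Y / ads_q Y) *: Y.
  apply: (@scalerI _ _ (2 : R)); first by rewrite pnatr_eq0.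
  by rewrite eX scalerA; congr (_ *: _); ring.
exists (ads_b X Y / ads_q Y) => //; move: (ads_b X Y / ads_q Y) eX => a eX.
have := ads_qZ a Y; rewrite -eX; have := sqr_ge0 a.
by case: uX => ->; case: uY => ->; lra.
Qed.

(** By commutation [ads_refl X] negates [ads_refl Y *m X], which is therefore a multiple of [X].
    Were [X] and [Y] not orthogonal, [Y] would be a multiple of [X] and the reflections would
    coincide. *)
Lemma ads_refl_comm_orth X Y : unit_normal X -> unit_normal Y ->
  ads_refl X *m ads_refl Y = ads_refl Y *m ads_refl X ->
  ads_refl X <> ads_refl Y -> ads_b X Y = 0.
Proof.
move=> uX uY XYC nXY; apply/eqP/negP => /negP XY0; apply: nXY.
have qX := unit_normal_neq0 uX; have qY := unit_normal_neq0 uY.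
have : ads_refl X *m (ads_refl Y *m X) = - (ads_refl Y *m X).
  by rewrite mulmxA XYC -mulmxA ads_reflN // mulmxN.
rewrite [ads_refl X *m _]ads_refl_mul ads_refl_mul.
set c := 2 / ads_q Y * ads_b X Y; set m := 2 / _ * _ => eX.
have c0 : c != 0 by rewrite !mulf_neq0 ?invr_neq0 ?pnatr_eq0.
(* [eX] says that 2 (X - c Y) = m X; this is its solution for [Y]. *)
have eY : Y = (c^-1 * (1 - m / 2)) *: X.
  apply: (@scalerI _ _ (2 * c)); first by rewrite mulf_neq0 ?pnatr_eq0.
  apply/matrixP => i j; move/matrixP/(_ i j): eX; rewrite !mxE => eX.
  have -> : 2 * c * (c^-1 * (1 - m / 2) * X i j) = (2 - m) * X i j.
    by field; rewrite c0.
  lra.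
rewrite eY ads_reflZ //; apply: contraNneq qY => a0.
by rewrite eY a0 ads_qZ; rewrite expr0n mul0r.
Qed.

End BilinearForm.

(** * Configurations of normal vectors *)

Lemma gamma_comm (g h : gen) :
  gen_comm g h -> (gamma g * gamma h = gamma h * gamma g)%g.
Proof.
move=> gh; rewrite /gamma /racg_gen [LHS]racg_word_cat [RHS]racg_word_cat.
exact/racg_wordP/racg_comm.
Qed.

Section Configurations.
Context {R : realType}.
Implicit Types (X : gen -> 'cV[R]_5) (e d : signs) (u : R).

(** The value of [ads_q] on [fvec t g], the same for all [t] in (-1, 1). *)
Definition gen_sign (g : gen) : R := if g is gen_p _ then -1 else 1.

(** The equations of [Hom_0] lifted to unit normals with the signs chosen as for [fvec t]: where
    [Hom_0] prescribes an absolute value, the product itself is prescribed. *)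
Definition config X : Prop :=
  [/\ forall g, ads_q (X g) = gen_sign g,
      forall g h, gen_comm g h -> ads_b (X g) (X h) = 0 &
      forall g h, gen_asym g h -> ads_b (X g) (X h) = - gen_sign g].

Lemma gen_sign_neq0 g : gen_sign g != 0.
Proof. by case: g => *; rewrite ?oppr_eq0 oner_eq0. Qed.

Lemma gen_sign_normal g (x : 'cV[R]_5) : ads_q x = gen_sign g -> unit_normal x.
Proof. by rewrite /unit_normal => ->; case: g; [right|left|left]. Qed.

Lemma ads_isometry_config (A : 'M[R]_5) X :
  ads_isometry A -> config X -> config (fun g => A *m X g).
Proof.
move=> iA [qX cX aX]; split=> [g|g h gh|g h gh].
- by rewrite /ads_q ads_isometry_b // -/(ads_q _) qX.
- by rewrite ads_isometry_b // cX.
- by rewrite ads_isometry_b // aX.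
Qed.

Section ConfigRepresentation.
Variables (X : gen -> 'cV[R]_5) (cX : config X).
Let r g : 'M[R]_5 := ads_refl (X g).

Let normalX g : unit_normal (X g).
Proof. by case: cX => qX _ _; exact: gen_sign_normal (qX g). Qed.

Let r2 g : r g * r g = 1.
Proof. exact: ads_refl_invol. Qed.

Let rC g h : gen_comm g h -> r g * r h = r h * r g.
Proof. by case: cX => _ cX' _ /cX'; exact: ads_refl_comm. Qed.

Lemma config_gamma g : racg_lift (comm := gen_comm) r (gamma g) = r g.
Proof. exact: racg_lift_gen. Qed.

Lemma config_Hom_0 : Hom_0 (racg_lift (comm := gen_comm) r).
Proof.
have [qX cX' aX] := cX; split; last first.
  (* Unit normals of one reflection differ by a factor of square 1, so [x] and [y] can be replaced
     by the normals of the configuration. *)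
  move=> g h gh x y ux uy; rewrite !config_gamma.
  move=> /esym /(ads_refl_eqP ux (normalX g))[a a2 ->].
  move=> /esym /(ads_refl_eqP uy (normalX h))[b b2 ->].
  have n1 (c : R) : c ^+ 2 = 1 -> `|c| = 1.
    by move=> c2; rewrite -[`|c|]sqrtr_sqr c2 sqrtr1.
  rewrite !ads_b_lin !normrM n1 // (n1 b) // !mul1r aX //.
  by rewrite normrN; case: (g) => *; rewrite ?normrN normr1.
split; first split.
- move=> x v; rewrite /racg_lift; elim: (racg_repr x) v => [|g s IHs] v.
    by rewrite big_nil mul1mx.
  by rewrite big_cons -mulmxA ads_refl_isom.
- exact: racg_lift1.
- by move=> x y; exact: racg_liftM.
- by move=> g; exists (X g); rewrite ?config_gamma.
(* If the reflections were equal, orthogonality would make [r h] fix the vector [X g] that [r g]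
   negates, forcing [X g] to be 0. *)
- move=> g h gh; rewrite !config_gamma => rgh.
  have := ads_reflN (normalX g); rewrite -[ads_refl _]/(r g) rgh.
  rewrite ads_refl_orth ?cX' // => Xg.
  have : ads_q (X g) = 0.
    have Xg0 : X g = 0.
      apply: (@scalerI _ _ (2 : R)); first by rewrite pnatr_eq0.
      by rewrite scaler0 scaler_nat mulr2n {1}Xg addNr.
    by rewrite Xg0 -(scale0r (0 : 'cV[R]_5)) ads_qZ expr0n mul0r.
  by apply/eqP; rewrite qX gen_sign_neq0.
Qed.

End ConfigRepresentation.

Lemma big_ord3 (T : Type) (idx : T) (op : Monoid.law idx) (F : 'I_3 -> T) :
  \big[op/idx]_(k < 3) F k = op (op (F 0) (F 1)) (F 2).
Proof.
rewrite !big_ord_recl big_ord0 Monoid.mulm1 Monoid.mulmA.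
have -> : lift ord0 ord0 = 1 :> 'I_3 by apply: val_inj.
by have -> : lift ord0 (lift ord0 ord0) = 2 :> 'I_3 by apply: val_inj.
Qed.

Lemma ord3P (k : 'I_3) : [\/ k = 0, k = 1 | k = 2].
Proof.
by case: k => [[|[|[|//]]]] ?; [apply: Or31|apply: Or32|apply: Or33];
  apply: val_inj.
Qed.

Lemma ndiffE e d :
  ndiff e d = ((e 0%R != d 0%R) + (e 1%R != d 1%R) + (e 2%R != d 2%R))%N.
Proof.
rewrite /ndiff -sum1_card big_mkcond big_ord3 /= !inE.
by do 3!case: (_ != _).
Qed.

Lemma ndiff_flip e d k : (forall j, j != k -> e j = d j) -> e k != d k ->
  ndiff e d = 1%N.
Proof.
move=> ed ek; rewrite /ndiff -[RHS](card1 k); apply: eq_card => j.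
rewrite !inE; have [->|/ed ->] := eqVneq j k; first by rewrite ek.
by rewrite eqxx.
Qed.

Lemma ndiffxx e : ndiff e e = 0%N.
Proof. by rewrite /ndiff eq_card0 // => j; rewrite inE eqxx. Qed.

Lemma ads_b_vec5 (x0 x1 x2 x3 x4 y0 y1 y2 y3 y4 : R) :
  ads_b (vec5 x0 x1 x2 x3 x4) (vec5 y0 y1 y2 y3 y4) =
  - x0 * y0 + x1 * y1 + x2 * y2 + x3 * y3 - x4 * y4.
Proof.
rewrite /ads_b !big_ord_recl big_ord0 !mxE /ads_sign /=; ring.
Qed.

Lemma fvec_l u k s : fvec u (gen_l k s) = vec5 1
  (if k == 0 then sg R s * Num.sqrt 2 else 0)
  (if k == 1 then sg R s * Num.sqrt 2 else 0)
  (if k == 2 then sg R s * Num.sqrt 2 else 0) 0.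
Proof.
apply/matrixP => i j; rewrite ord1 !mxE eqxx !andbT.
have -> : (i == inord k.+1) = (i == k.+1 :> nat).
  by rewrite -val_eqE /= inordK // ltnS (ltn_trans (ltn_ord k)).
case: k => [[|[|[|//]]]] ? /=; case: i => [[|[|[|[|[|//]]]]]] ? /=;
  by rewrite ?mulr1 ?mulr0 ?addr0 ?add0r.
Qed.

Lemma sigmaE e : sigma R e = sg R (e 0) * sg R (e 1) * sg R (e 2).
Proof.
exact: big_ord3.
Qed.

Lemma sqr_sqrt2 : Num.sqrt 2 ^+ 2 = 2 :> R.
Proof. by rewrite sqr_sqrtr. Qed.

Lemma sgM (a b : bool) : sg R a * sg R b = 1 - 2 * (a != b)%:R.
Proof. by rewrite /sg; case: a; case: b; rewrite /= ?expr0 ?expr1; ring. Qed.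

Lemma sg_dot e d : sg R (e 0) * sg R (d 0) + sg R (e 1) * sg R (d 1) +
  sg R (e 2) * sg R (d 2) = 3 - 2 * (ndiff e d)%:R.
Proof. by rewrite !sgM ndiffE !natrD; ring. Qed.

Lemma sigmaM e d : (ndiff e d <= 1)%N ->
  sigma R e * sigma R d = 1 - 2 * (ndiff e d)%:R.
Proof.
rewrite !sigmaE mulrACA (mulrACA (sg R (e 0))) !sgM ndiffE.
by case: (_ != _); case: (_ != _); case: (_ != _) => //= _; ring.
Qed.

(** For vertices at distance n at most 1, the three sign products add up to 3 - 2n and the first
    coordinate contributes -2, the square of [s]. The result 1 - 2n is also the product of the two
    [sigma], so mixed products of p and m cancel and the others keep the factor 1 - u^2, which [r]
    normalises. *)
Lemma fvec_config u : -1 < u < 1 -> config (fvec u).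
Proof.
move=> u1; have u2 : 0 < 1 - u ^+ 2 by nra.
pose r := (Num.sqrt (1 - u ^+ 2))^-1; pose s := Num.sqrt 2 : R.
have s2 : s ^+ 2 = 2 := sqr_sqrt2.
have r2 : r ^+ 2 * (1 - u ^+ 2) = 1.
  by rewrite exprVn sqr_sqrtr ?mulVf ?gt_eqF // ltW.
have sgg (b : bool) : sg R b * sg R b = 1 by rewrite sgM eqxx /=; ring.
have pp e d : ads_b (fvec u (gen_p e)) (fvec u (gen_p d)) = r ^+ 2 *
    (u ^+ 2 * (sg R (e 0) * sg R (d 0) + sg R (e 1) * sg R (d 1) +
               sg R (e 2) * sg R (d 2) - s ^+ 2) - sigma R e * sigma R d).
  by rewrite !ads_b_lin ads_b_vec5 -/r -/s; ring.
have mm e d : ads_b (fvec u (gen_m e)) (fvec u (gen_m d)) = r ^+ 2 *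
    (sg R (e 0) * sg R (d 0) + sg R (e 1) * sg R (d 1) +
     sg R (e 2) * sg R (d 2) - s ^+ 2 - u ^+ 2 * (sigma R e * sigma R d)).
  by rewrite !ads_b_lin ads_b_vec5 -/r -/s; ring.
have pm e d : (ndiff e d <= 1)%N ->
    ads_b (fvec u (gen_p e)) (fvec u (gen_m d)) = 0.
  move=> ed; transitivity (r ^+ 2 * u *
    (sg R (e 0) * sg R (d 0) + sg R (e 1) * sg R (d 1) +
     sg R (e 2) * sg R (d 2) - s ^+ 2 - sigma R e * sigma R d)).
    by rewrite !ads_b_lin ads_b_vec5 -/r -/s; ring.
  by rewrite sg_dot sigmaM // s2; ring.
have pl e k b : e k == b ->
    ads_b (fvec u (gen_p e)) (fvec u (gen_l k b)) = 0.
  move=> /eqP <-; transitivity (r * u * s * (sg R (e k) * sg R (e k) - 1)).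
    rewrite fvec_l ads_bZl ads_b_vec5 -/r -/s.
    by case: (ord3P k) => -> /=; ring.
  by rewrite sgg; ring.
have ml e k b : e k == b ->
    ads_b (fvec u (gen_m e)) (fvec u (gen_l k b)) = 0.
  move=> /eqP <-; transitivity (r * s * (sg R (e k) * sg R (e k) - 1)).
    rewrite fvec_l ads_bZl ads_b_vec5 -/r -/s.
    by case: (ord3P k) => -> /=; ring.
  by rewrite sgg; ring.
split.
- case=> [e|e|k b]; rewrite /ads_q.
  + by rewrite pp sg_dot sigmaM ?ndiffxx //= s2; lra.
  + by rewrite mm sg_dot sigmaM ?ndiffxx //= s2; lra.
  + transitivity (s ^+ 2 * (sg R b * sg R b) - 1); last first.
      by rewrite s2 sgg /=; ring.
    by rewrite fvec_l ads_b_vec5 -/s; case: (ord3P k) => -> /=; ring.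
- case=> [e|e|k b] [d|d|l c] //=; [exact: pm|exact: pl| |exact: ml| |] => gh.
  + by rewrite ads_bC pm.
  + by rewrite ads_bC pl.
  + by rewrite ads_bC ml.
- case=> [e|e|k b] [d|d|l c] //; rewrite /gen_asym.
  + by move=> /eqP ed; rewrite pp sg_dot sigmaM ed //= s2; lra.
  + by move=> /eqP ed; rewrite mm sg_dot sigmaM ed //= s2; lra.
  + rewrite !fvec_l ads_b_vec5.
    by case: (ord3P k) => ->; case: (ord3P l) => -> //= _; ring.
Qed.

End Configurations.

(** * Frames at the vertices of the cube and relations along its edges *)

Section Rigidity.
Context {R : realType}.
Implicit Types (X Y : gen -> 'cV[R]_5) (e d : signs) (i j k : 'I_3).

Definition frame_gen e (n : 'I_5) : gen :=
  match val n with
  | 0 => gen_l 0 (e 0)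
  | 1 => gen_l 1 (e 1)
  | 2 => gen_l 2 (e 2)
  | 3 => gen_p e
  | _ => gen_m e
  end.

Definition frame X e : 'M[R]_5 := \matrix_(n, a) X (frame_gen e a) n 0.

Definition frame_gram : 'M[R]_5 := \matrix_(a, b)
  (if (val a < 3)%N && (val b < 3)%N then if a == b then 1 else -1
   else if a == b then if val a == 3%N then -1 else 1 else 0).

(** The block of the three walls in [frame_gram] is 2 I - E, with E the all-ones matrix; its inverse
    is (I - E) / 2. *)
Definition frame_gram_inv : 'M[R]_5 := \matrix_(a, b)
  (if (val a < 3)%N && (val b < 3)%N then if a == b then 0 else - 2^-1
   else if a == b then if val a == 3%N then -1 else 1 else 0).

Lemma frame_gramK : frame_gram_inv *m frame_gram = 1%:M.
Proof.
apply/matrixP => a b; rewrite !mxE !big_ord_recl big_ord0 !mxE -!val_eqE /=.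
case: a => [[|[|[|[|[|//]]]]]] ? /=; case: b => [[|[|[|[|[|//]]]]]] ? /=;
  by field.
Qed.

Lemma tr_frame_gram_inv : frame_gram_inv^T = frame_gram_inv.
Proof.
apply/matrixP => a b; rewrite !mxE andbC [b == a]eq_sym.
by case: eqP => [->|].
Qed.

Lemma col_frame X e n : col n (frame X e) = X (frame_gen e n).
Proof. by apply/matrixP => a b; rewrite !mxE ord1. Qed.

Lemma config_frame X e : config X ->
  (frame X e)^T *m ads_J *m frame X e = frame_gram.
Proof.
move=> [qX cX aX]; have qX' g : ads_b (X g) (X g) = gen_sign g := qX g.
apply/matrixP => a b; rewrite gram_mxE !col_frame [RHS]mxE -!val_eqE.
by case: a => [[|[|[|[|[|//]]]]]] ? /=; case: b => [[|[|[|[|[|//]]]]]] ? /=;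
  rewrite /frame_gen /=; first [by rewrite qX' | by rewrite aX
                               | by rewrite cX //= ?ndiffxx].
Qed.

(** The Gram matrix gives a left inverse of the frame, which for a square matrix is also a right
    inverse. This expands any vector in the frame from its products with the frame. *)
Lemma frame_resolution X e : config X ->
  frame X e *m (frame_gram_inv *m (frame X e)^T *m ads_J) = 1%:M.
Proof.
move=> cX; apply: mulmx1C.
by rewrite -!mulmxA (mulmxA _ ads_J) config_frame // frame_gramK.
Qed.

(** This is the tool for vector identities: it suffices to compare the products of both sides with
    the five frame vectors. *)
Lemma frame_nondegenerate X e (w : 'cV[R]_5) : config X ->
  (forall k, ads_b (X (gen_l k (e k))) w = 0) ->
  ads_b (X (gen_p e)) w = 0 -> ads_b (X (gen_m e)) w = 0 -> w = 0.
Proof.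
move=> cX lw pw mw.
suff Fw : (frame X e)^T *m ads_J *m w = 0.
  by rewrite -[w]mul1mx -(frame_resolution e cX) -!mulmxA (mulmxA _^T) Fw !mulmx0.
apply/matrixP => n a; rewrite gram_mxE col_frame ord1 col_id [RHS]mxE.
by case: n => [[|[|[|[|[|//]]]]]] ?; rewrite /frame_gen /=.
Qed.

(* The linear map sending the frame of Y at e to the frame of X at e. *)
Definition transport e Y X : 'M[R]_5 :=
  frame X e *m frame_gram_inv *m (frame Y e)^T *m ads_J.

(** The two frames have the same Gram matrix [frame_gram]. *)
Lemma transport_isometry e Y X : config X -> config Y ->
  ads_isometry (transport e Y X).
Proof.
move=> cX cY; rewrite /ads_isometry /transport.
rewrite !trmx_mul trmxK tr_ads_J tr_frame_gram_inv.
rewrite -!mulmxA (mulmxA ads_J (frame X e)) (mulmxA _^T (ads_J *m _)).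
rewrite (mulmxA _^T ads_J) config_frame // (mulmxA frame_gram_inv frame_gram).
rewrite frame_gramK mul1mx -[RHS]mulmx1; congr (_ *m _).
by rewrite -(frame_resolution e cY) !mulmxA.
Qed.

Lemma transport_frame e Y X : config Y ->
  transport e Y X *m frame Y e = frame X e.
Proof.
move=> cY; rewrite /transport -!mulmxA (mulmxA _ ads_J) config_frame //.
by rewrite frame_gramK mulmx1.
Qed.

Lemma transport_gen e Y X n : config Y ->
  transport e Y X *m Y (frame_gen e n) = X (frame_gen e n).
Proof.
by move=> cY; rewrite -!col_frame colE mulmxA transport_frame // -colE.
Qed.

Lemma ord3_cover i j k (l : 'I_3) : i != j -> i != k -> j != k ->
  [\/ l = i, l = j | l = k].
Proof.
move=> ij ik jk.
have u3 : uniq [:: i; j; k] by rewrite /= !inE negb_or ij ik jk.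
have /subset_cardP ijk : #|[:: i; j; k]| = #|'I_3|.
  by rewrite (card_uniqP u3) card_ord.
have := ijk (subset_predT _) l; rewrite !inE => /or3P[] /eqP ->.
- exact: Or31.
- exact: Or32.
- exact: Or33.
Qed.

Section Edge.
Variables (X : gen -> 'cV[R]_5) (cX : config X).
Local Notation b g h := (ads_b (X g) (X h)).

Lemma config_q g : b g g = gen_sign g.
Proof. by case: cX => qX _ _; exact: qX. Qed.

Lemma config_ll i j s s' : i != j -> b (gen_l i s) (gen_l j s') = -1.
Proof. by case: cX => _ _ aX ij; rewrite aX. Qed.

Definition gen_pm (m : bool) e : gen := if m then gen_m e else gen_p e.

Lemma config_pml m e k s : e k == s -> b (gen_pm m e) (gen_l k s) = 0.
Proof. by case: cX => _ cX' _; case: m => ek; apply: cX'. Qed.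

Lemma config_pm e d : (ndiff e d <= 1)%N -> b (gen_p e) (gen_m d) = 0.
Proof. by case: cX => _ cX' _ ed; apply: cX'. Qed.

(* The vectors orthogonal to l_i, l_j, p and m form the line spanned by the null
   vector l_i + l_j. *)
Lemma frame_orth_line e i j k (v : 'cV[R]_5) : i != j -> i != k -> j != k ->
  ads_b (X (gen_l i (e i))) v = 0 -> ads_b (X (gen_l j (e j))) v = 0 ->
  ads_b (X (gen_p e)) v = 0 -> ads_b (X (gen_m e)) v = 0 ->
  v = (- (ads_b (X (gen_l k (~~ e k))) v / 2)) *:
      (X (gen_l i (e i)) + X (gen_l j (e j))).
Proof.
move=> ij ik jk vi vj vp vm.
have ji : j != i by rewrite eq_sym.
have ki : k != i by rewrite eq_sym.
have kj : k != j by rewrite eq_sym.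
(* [n] has product -2 with both walls in direction [k], so either of the two products of [v] yields
   its coefficient. The frame contains the wall of sign [e k]; the conclusion uses the opposite
   one. *)
set n := _ + _; pose a := - (ads_b (X (gen_l k (e k))) v / 2).
have vE : v = a *: n.
  apply/subr0_eq/(@frame_nondegenerate _ e _ cX).
  - move=> l; case: (ord3_cover l ij ik jk) => ->;
      rewrite /n !ads_b_lin ?config_q /= ?vi ?vj !config_ll // /a; lra.
  - by rewrite /n !ads_b_lin vp !(config_pml false) //; lra.
  - by rewrite /n !ads_b_lin vm !(config_pml true) //; lra.
suff -> : ads_b (X (gen_l k (~~ e k))) v = - 2 * a.
  by rewrite {1}vE; congr (_ *: _); field.
by rewrite {1}vE /n !ads_b_lin !config_ll //; lra.
Qed.

(** The sum of the two normals is orthogonal to the common walls and to the p and m normals at [e]: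
    with the one of the same kind, the value for an asymptotic pair cancels the norm. So
    [frame_orth_line] applies to the sum. *)
Lemma config_edge m e d i j k : i != j -> i != k -> j != k ->
  e i = d i -> e j = d j -> d k = ~~ e k ->
  X (gen_pm m d) = - X (gen_pm m e) -
    (b (gen_pm m e) (gen_l k (d k)) / 2) *:
      (X (gen_l i (e i)) + X (gen_l j (e j))).
Proof.
move=> ij ik jk ei ej dk.
have ed : ndiff e d = 1%N.
  apply: (@ndiff_flip _ _ k) => [l lk|]; last by rewrite dk; case: (e k).
  by case: (ord3_cover l ij ik jk) lk => -> //; rewrite eqxx.
have de : ndiff d e = 1%N.
  by rewrite -ed; apply: eq_card => l; rewrite !inE eq_sym.
apply/eqP; rewrite addrC -subr_eq opprK; apply/eqP.
rewrite [LHS](@frame_orth_line e i j k) //.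
- rewrite !ads_b_lin -dk ads_bC config_pml // add0r.
  by rewrite (ads_bC (X (gen_l k _))) scaleNr.
- by rewrite !ads_b_lin ads_bC !(ads_bC (X (gen_l i _))) !config_pml ?addr0 // ei.
- by rewrite !ads_b_lin !(ads_bC (X (gen_l j _))) !config_pml ?addr0 // ej.
- rewrite !ads_b_lin; case: m; last first.
    case: cX => _ _ aX; rewrite config_q aX /= ?ed //; lra.
  by rewrite !config_pm ?ed ?ndiffxx // addr0.
- rewrite !ads_b_lin; case: m.
    case: cX => _ _ aX; rewrite config_q aX /= ?ed //; lra.
  by rewrite !(ads_bC (X (gen_m e))) !config_pm ?de ?ndiffxx // addr0.
Qed.

End Edge.
End Rigidity.

(** * Rigidity *)

Section Values.
Context {R : realType}.
Implicit Types (X Y : gen -> 'cV[R]_5) (e d : signs) (i j k : 'I_3) (m : bool).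

Definition flip e k : signs := [ffun j => if j == k then ~~ e j else e j].

Lemma flip_id e k : flip e k k = ~~ e k.
Proof. by rewrite ffunE eqxx. Qed.

Lemma flip_neq e j k : j != k -> flip e k j = e j.
Proof. by move=> /negPf jk; rewrite ffunE jk. Qed.

Lemma flipC e j k : flip (flip e j) k = flip (flip e k) j.
Proof. by apply/ffunP => i; rewrite !ffunE; do 2!case: (_ == _). Qed.

Lemma ord3_third j k : j != k -> exists i, i != j /\ i != k.
Proof.
case: j => [[|[|[|//]]]] ?; case: k => [[|[|[|//]]]] ? // _;
  by [exists 0|exists 1|exists 2].
Qed.

(** Flipping [j] and [k] in either order leads to the same vertex. Pairing the two resulting
    expressions with the wall [gen_l j (e j)] gives the equation multiplied, up to a constant, by
    [cj - 1]. *)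
Lemma config_flip2 X e m j k : config X -> j != k ->
  ads_b (X (gen_l j (e j))) (X (gen_l j (~~ e j))) != 1 ->
  4 * ads_b (X (gen_pm m e)) (X (gen_l k (~~ e k))) =
  ads_b (X (gen_pm m e)) (X (gen_l j (~~ e j))) *
    (1 - ads_b (X (gen_l k (e k))) (X (gen_l k (~~ e k)))).
Proof.
move=> cX jk; have [i [ij ik]] := ord3_third jk.
have kj : k != j by rewrite eq_sym.
have ji : j != i by rewrite eq_sym.
have ki : k != i by rewrite eq_sym.
have Ek := config_edge (d := flip e k) (e := e) cX m ij ik jk.
have Ej := config_edge (d := flip e j) (e := e) cX m ik ij kj.
have Ekj := config_edge (d := flip (flip e k) j) (e := flip e k) cX m ik ij kj.
have Ejk := config_edge (d := flip (flip e j) k) (e := flip e j) cX m ij ik jk.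
rewrite !(flip_id, flip_neq) // in Ek Ej Ekj Ejk.
have {}Ek := Ek erefl erefl erefl; have {}Ej := Ej erefl erefl erefl.
have {}Ekj := Ekj erefl erefl erefl; have {}Ejk := Ejk erefl erefl erefl.
set cj := ads_b _ _; set zk := ads_b _ _; set zj := ads_b _ _.
set ck := ads_b _ _ => cj1.
have zkj : ads_b (X (gen_pm m (flip e k))) (X (gen_l j (~~ e j))) =
    - zj - zk / 2 * (-1 + cj).
  by rewrite Ek !ads_b_lin config_ll // /zk /zj /cj; lra.
have zjk : ads_b (X (gen_pm m (flip e j))) (X (gen_l k (~~ e k))) =
    - zk - zj / 2 * (-1 + ck).
  by rewrite Ej !ads_b_lin config_ll // /zk /zj /ck; lra.
have xkj : ads_b (X (gen_pm m (flip e k))) (X (gen_l j (e j))) = 0.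
  by rewrite config_pml // flip_neq.
have xjk : ads_b (X (gen_pm m (flip e j))) (X (gen_l j (e j))) = zj.
  rewrite Ej !ads_b_lin !config_ll // config_pml // /zj; lra.
have := congr1 (fun v : 'cV[R]_5 => ads_b v (X (gen_l j (e j)))) Ekj.
rewrite flipC /= Ejk !ads_b_lin zkj zjk xkj xjk.
rewrite !(config_ll cX _ _ ij) !(config_ll cX _ _ kj).
rewrite (ads_bC (X (gen_l j (~~ e j)))) -/cj.
move: zk zj cj ck cj1 {zkj zjk xkj xjk Ek Ej Ekj Ejk} => zk zj cj ck cj1 E.
have : (cj - 1) * (4 * zk - zj * (1 - ck)) = 0 by lra.
by move/eqP; rewrite mulf_eq0 subr_eq0 (negPf cj1) subr_eq0 => /eqP.
Qed.

(** The vertex +++, since [false] encodes the sign 1. *)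
Definition signs0 : signs := [ffun=> false].

Definition l_value X k : R := ads_b (X (gen_l k false)) (X (gen_l k true)).

Definition pm_value X m k : R := ads_b (X (gen_pm m signs0)) (X (gen_l k true)).

(* Open conditions, satisfied by fvec t, which exclude the spurious solutions of
   the equations. *)
Definition nondegenerate_config X : Prop :=
  (forall k, l_value X k < 0) /\ pm_value X true 0 < 0.

Lemma config_flip_signs0 X m j k :
  config X -> nondegenerate_config X -> j != k ->
  4 * pm_value X m k = pm_value X m j * (1 - l_value X k).
Proof.
move=> cX [l0 _] jk; have := @config_flip2 X signs0 m j k cX jk.
by rewrite !ffunE; apply; rewrite lt_eqF // (lt_trans (l0 j)).
Qed.

(** The m products do not vanish, so using [config_flip_signs0] in both directions gives (1 - l_i)(1
    - l_j) = 16 for all i != j. Eliminating two of the three unknowns leaves (1 - l_k)^2 = 16, and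
    l_k < 0 selects the root 4. *)
Lemma l_valueE X k : config X -> nondegenerate_config X -> l_value X k = -3.
Proof.
move=> cX nX; have [l0 z0] := nX.
have zn0 j : pm_value X true j != 0.
  have [->|j0] := eqVneq j 0; first by rewrite lt_eqF.
  have := config_flip_signs0 true cX nX j0.
  by apply: contra_eqN => /eqP ->; rewrite mul0r lt_eqF // pmulr_rlt0.
have w16 i j : i != j -> (1 - l_value X i) * (1 - l_value X j) = 16.
  move=> ij; have ji : j != i by rewrite eq_sym.
  have Ej := config_flip_signs0 true cX nX ij.
  have Ei := config_flip_signs0 true cX nX ji.
  by apply: (mulfI (zn0 j)); rewrite mulrA -Ei -mulrA -Ej; ring.
have [i [j [ij ik jk]]] : exists i j, [/\ i != j, i != k & j != k].
  by case: (ord3P k) => ->; [exists 1, 2|exists 0, 2|exists 0, 1].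
have := w16 _ _ ij; have := w16 _ _ ik; have := w16 _ _ jk.
have := l0 k; move: (l_value X i) (l_value X j) (l_value X k).
move=> a b c c0 bc ac ab.
have : (1 - c - 4) * (1 - c + 4) = 0.
  apply: (mulfI (_ : 16 != 0 :> R)); first by rewrite pnatr_eq0.
  have : (1 - b) * (1 - c) * ((1 - a) * (1 - c)) = 16 * 16 by rewrite bc ac.
  have -> : (1 - b) * (1 - c) * ((1 - a) * (1 - c)) =
    ((1 - a) * (1 - b)) * (1 - c) ^+ 2 by ring.
  rewrite ab; lra.
move/eqP; rewrite mulf_eq0 => /orP[] /eqP; lra.
Qed.

Lemma pm_valueE X m k : config X -> nondegenerate_config X ->
  pm_value X m k = pm_value X m 0.
Proof.
move=> cX nX; have [->//|k0] := eqVneq k 0.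
have := config_flip_signs0 m cX nX k0; rewrite l_valueE //; lra.
Qed.

(** Expand the wall [gen_l 0 true] in the frame at [signs0]; that its norm is 1 is the equation. *)
Lemma pm_value_hyperbola X : config X -> nondegenerate_config X ->
  pm_value X true 0 ^+ 2 - pm_value X false 0 ^+ 2 = 8.
Proof.
move=> cX nX; set y := pm_value X false 0; set z := pm_value X true 0.
have l3 := l_valueE 0 cX nX; rewrite /l_value in l3.
have yE : ads_b (X (gen_p signs0)) (X (gen_l 0 true)) = y by [].
have zE : ads_b (X (gen_m signs0)) (X (gen_l 0 true)) = z by [].
have pl k : ads_b (X (gen_p signs0)) (X (gen_l k false)) = 0.
  by apply: (config_pml cX false); rewrite ffunE.
have ml k : ads_b (X (gen_m signs0)) (X (gen_l k false)) = 0.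
  by apply: (config_pml cX true); rewrite ffunE.
have pm : ads_b (X (gen_p signs0)) (X (gen_m signs0)) = 0.
  by apply: (config_pm cX); rewrite ndiffxx.
(* The coefficients are [frame_gram_inv] applied to the products -3, -1, -1, y, z with the frame. *)
have E : X (gen_l 0 true) = X (gen_l 0 false) +
    2 *: (X (gen_l 1 false) + X (gen_l 2 false)) - y *: X (gen_p signs0) +
    z *: X (gen_m signs0).
  apply/subr0_eq/(@frame_nondegenerate _ X signs0 _ cX).
  - move=> k; rewrite ffunE !ads_b_lin !(ads_bC _ (X (gen_p _))).
    rewrite !(ads_bC _ (X (gen_m _))) pl ml.
    have [->|k0] := eqVneq k 0.
      by rewrite l3 config_q // !config_ll //=; lra.
    have l0E s : ads_b (X (gen_l k false)) (X (gen_l 0 s)) = -1.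
      by rewrite config_ll.
    rewrite !l0E.
    have [->|k1] := eqVneq k 1.
      by rewrite config_q // config_ll //=; lra.
    have -> : k = 2.
      by case: (ord3P k) k0 k1 => ->.
    by rewrite config_q // config_ll //=; lra.
  - by rewrite !ads_b_lin yE !pl pm config_q //=; lra.
  - rewrite !ads_b_lin zE !ml (ads_bC (X (gen_m _)) (X (gen_p _))) pm.
    by rewrite config_q //=; lra.
have := config_q cX (gen_l 0 true); rewrite {1}E !ads_b_lin l3 yE zE.
by rewrite !config_ll //=; lra.
Qed.

(** The values prescribe the products of each wall [gen_l k true] with the frame at [signs0], hence
    that wall. With all walls known, [config_edge] carries the p and m normals from vertex to
    vertex. *)
Lemma config_rigid X Y : config X -> config Y ->
  (forall n, X (frame_gen signs0 n) = Y (frame_gen signs0 n)) ->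
  (forall k, l_value X k = l_value Y k) ->
  (forall m k, pm_value X m k = pm_value Y m k) ->
  forall g, X g = Y g.
Proof.
move=> cX cY fXY lXY pXY.
have lfXY k : X (gen_l k false) = Y (gen_l k false).
  have f0 := fXY (@Ordinal 5 0 isT); have f1 := fXY (@Ordinal 5 1 isT).
  have f2 := fXY (@Ordinal 5 2 isT); rewrite /frame_gen /= !ffunE in f0 f1 f2.
  by case: (ord3P k) => ->.
have p0XY m : X (gen_pm m signs0) = Y (gen_pm m signs0).
  by case: m; [exact: fXY (@Ordinal 5 4 isT)|exact: fXY (@Ordinal 5 3 isT)].
have ltXY k : X (gen_l k true) = Y (gen_l k true).
  apply/subr0_eq/(@frame_nondegenerate _ X signs0 _ cX).
  - move=> j; rewrite ffunE !ads_b_lin.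
    have [->|jk] := eqVneq j k.
      by have := lXY k; rewrite /l_value -lfXY; lra.
    by rewrite config_ll // lfXY config_ll //; lra.
  - by have := pXY false k; rewrite /pm_value -(p0XY false) /= !ads_b_lin; lra.
  - by have := pXY true k; rewrite /pm_value -(p0XY true) /= !ads_b_lin; lra.
have lXYE k s : X (gen_l k s) = Y (gen_l k s) by case: s.
have stepXY e k : (forall m, X (gen_pm m e) = Y (gen_pm m e)) ->
    forall m, X (gen_pm m (flip e k)) = Y (gen_pm m (flip e k)).
  move=> eXY m.
  have [i [j [ij ik jk]]] : exists i j, [/\ i != j, i != k & j != k].
    by case: (ord3P k) => ->; [exists 1, 2|exists 0, 2|exists 0, 1].
  rewrite (config_edge (e := e) cX m ij ik jk) ?flip_id ?flip_neq //.
  rewrite (config_edge (e := e) cY m ij ik jk) ?flip_id ?flip_neq //.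
  by rewrite !lXYE !eXY.
have pmXY e m : X (gen_pm m e) = Y (gen_pm m e).
  (* A path from [signs0] to [e] that corrects one coordinate at a time: [en n] agrees with [e] on
     the first [n] coordinates and is [false] beyond. *)
  pose en n : signs := [ffun k : 'I_3 => e k && (k < n)%N].
  suff enXY n : (n <= 3)%N ->
      forall m, X (gen_pm m (en n)) = Y (gen_pm m (en n)).
    have -> : e = en 3%N by apply/ffunP => k; rewrite ffunE ltn_ord andbT.
    exact: enXY.
  elim: n => [_|n IHn n3].
    by have -> : en 0%N = signs0 by apply/ffunP => k; rewrite !ffunE ltn0 andbF.
  pose k := Ordinal n3.
  have [ek|ek] := boolP (e k).
    suff -> : en n.+1 = flip (en n) k by apply/stepXY/IHn/ltnW.
    apply/ffunP => j; rewrite !ffunE ltnS leq_eqVlt.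
    have [->|jk] := eqVneq j k; first by rewrite /= eqxx ek ltnn.
    by rewrite -[_ == n]/(val j == val k) val_eqE (negPf jk).
  suff -> : en n.+1 = en n by apply/IHn/ltnW.
  apply/ffunP => j; rewrite !ffunE ltnS leq_eqVlt.
  have [->|jk] := eqVneq j k; first by rewrite (negPf ek).
  by rewrite -[_ == n]/(val j == val k) val_eqE (negPf jk).
by case=> [e|e|k s]; [exact: (pmXY e false)|exact: (pmXY e true)|].
Qed.

End Values.

(** * Products along the family [fvec] *)

Section FamilyValues.
Context {R : realType}.
Implicit Type u : R.

Lemma fvec_pm_true u k : pm_value (fvec u) true k =
  - 2 * Num.sqrt 2 / Num.sqrt (1 - u ^+ 2).
Proof.
rewrite /pm_value fvec_l /= ads_b_lin ads_b_vec5 !ffunE /sg expr0 expr1.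
by case: (ord3P k) => -> /=; ring.
Qed.

Lemma fvec_pm_value u k :
  pm_value (fvec u) false k = u * pm_value (fvec u) true k.
Proof.
rewrite fvec_pm_true /pm_value fvec_l /= ads_b_lin ads_b_vec5 !ffunE /sg.
by rewrite expr0 expr1; case: (ord3P k) => -> /=; ring.
Qed.

Lemma fvec_nondegenerate u : -1 < u < 1 -> nondegenerate_config (fvec u).
Proof.
move=> u1; split=> [k|].
  rewrite /l_value !fvec_l ads_b_vec5 /sg expr0 expr1.
  by have s2 := @sqr_sqrt2 R; case: (ord3P k) => -> /=; lra.
rewrite fvec_pm_true mulNr mulNr oppr_lt0 divr_gt0 ?mulr_gt0 ?sqrtr_gt0 //.
by nra.
Qed.

End FamilyValues.

(** * Nondegenerate configurations as isometric images of the family *)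

Section Rigidity.
Context {R : realType}.
Variable X : gen -> 'cV[R]_5.
Hypotheses (cX : config X) (nX : nondegenerate_config X).

Definition parameter : R := pm_value X false 0 / pm_value X true 0.

Lemma pm_value_parameter : pm_value X false 0 = parameter * pm_value X true 0.
Proof. by rewrite divfK // lt_eqF //; case: nX. Qed.

(** With u the parameter, the hyperbola reads z^2 (1 - u^2) = 8, so 1 - u^2 is positive. *)
Lemma parameter_bound : -1 < parameter < 1.
Proof.
have := pm_value_hyperbola cX nX; rewrite pm_value_parameter.
have [_] := nX; move: (pm_value X true 0) parameter => z u z0 E.
have z2 : 0 < z ^+ 2 by nra.
have : 0 < 1 - u ^+ 2 by rewrite -(pmulr_rgt0 _ z2); lra.
by move=> u2; apply/andP; split; nra.
Qed.

(** By [config_rigid] it is enough to match the frame at [signs0], which the transport does, the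
    wall products, which are all -3, and y and z. Given u = y / z, the hyperbola determines z up to
    sign, and z is negative on both sides. *)
Lemma config_transport g :
  X g = transport signs0 (fvec parameter) X *m fvec parameter g.
Proof.
have u1 := parameter_bound; have cf := fvec_config u1.
have nf := fvec_nondegenerate u1.
have iA := transport_isometry signs0 cX cf.
apply: (config_rigid cX (ads_isometry_config iA cf)) => [n|k|m k].
- by rewrite transport_gen.
- by rewrite /l_value ads_isometry_b // -!/(l_value _ _) !l_valueE.
- rewrite /pm_value ads_isometry_b // -!/(pm_value _ _ _) !(pm_valueE _ k) //.
  have Ef := pm_value_hyperbola cf nf; have EX := pm_value_hyperbola cX nX.
  have pf := fvec_pm_value parameter 0.
  rewrite pf in Ef; rewrite pm_value_parameter in EX.
  suff z_eq : pm_value X true 0 = pm_value (fvec parameter) true 0.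
    by case: m => //; rewrite pf pm_value_parameter z_eq.
  have [_ zf] := nf; have [_ zX] := nX.
  move: parameter (pm_value X true 0) (pm_value (fvec parameter) true 0)
    zX zf Ef EX u1 {pf cf nf iA} => u z z' z0 z'0 E' E u1.
  have u2 : 1 - u ^+ 2 != 0 by rewrite gt_eqF //; nra.
  have : (1 - u ^+ 2) * ((z - z') * (z + z')) = 0 by lra.
  move/eqP; rewrite !mulf_eq0 (negPf u2) /= => /orP[] /eqP; lra.
Qed.

End Rigidity.

(** * The Cayley transform *)

Section Cayley.
Context {R : realType}.
Implicit Types (A K S : 'M[R]_5) (v : 'rV[R]_11) (u : R).

Definition cayley A : 'M[R]_5 := (1%:M - A) *m invmx (1%:M + A).

Lemma cayley1D A : \det (1%:M + A) != 0 ->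
  1%:M + cayley A = 2 *: invmx (1%:M + A).
Proof.
move=> dA; have uA : 1%:M + A \in unitmx by rewrite unitmxE unitfE.
rewrite /cayley -{1}(mulmxV uA) -mulmxDl addrACA subrr addr0.
by rewrite -mulr2n -scaler_nat -scalemxAl mul1mx.
Qed.

Lemma cayley1B A : \det (1%:M + A) != 0 ->
  1%:M - cayley A = 2 *: (A *m invmx (1%:M + A)).
Proof.
move=> dA; have uA : 1%:M + A \in unitmx by rewrite unitmxE unitfE.
rewrite /cayley -{1}(mulmxV uA) -mulmxBl opprB addrC addrA subrK.
by rewrite -mulr2n -scaler_nat -scalemxAl.
Qed.

Lemma det_cayley1D A : \det (1%:M + A) != 0 -> \det (1%:M + cayley A) != 0.
Proof.
move=> dA; rewrite cayley1D // detZ mulf_neq0 ?expf_neq0 ?pnatr_eq0 //.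
by rewrite det_inv invr_neq0.
Qed.

(** Dividing the formula [cayley1B] by [cayley1D] leaves [A]. *)
Lemma cayleyK A : \det (1%:M + A) != 0 -> cayley (cayley A) = A.
Proof.
move=> dA; have uA : 1%:M + A \in unitmx by rewrite unitmxE unitfE.
rewrite {1}/cayley cayley1D // cayley1B // invmxZ; last first.
  rewrite unitmxE detZ unitfE mulf_neq0 ?expf_neq0 ?pnatr_eq0 //.
  by rewrite det_inv invr_neq0.
rewrite invmxK -scalemxAl -scalemxAr scalerA divff ?pnatr_eq0 // scale1r.
by rewrite mulmxKV.
Qed.

(** [S] is skew for the form, so passing to the adjoint exchanges 1 - S and 1 + S, and these two
    commute. *)
Lemma cayley_isometry K : \det (1%:M + ads_J *m K) != 0 -> K^T = - K ->
  ads_isometry (cayley (ads_J *m K)).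
Proof.
set S := ads_J *m K => dS KT.
have uS : 1%:M + S \in unitmx by rewrite unitmxE unitfE.
have ST : S^T *m ads_J = - (ads_J *m S).
  rewrite trmx_mul tr_ads_J KT !mulNmx -mulmxA ads_JJ mulmx1.
  by rewrite mulmxA ads_JJ mul1mx.
have BT : (1%:M - S)^T *m ads_J = ads_J *m (1%:M + S).
  by rewrite raddfB /= trmx1 mulmxBl ST opprK mul1mx mulmxDr mulmx1.
have DT : (1%:M + S)^T *m ads_J = ads_J *m (1%:M - S).
  by rewrite raddfD /= trmx1 mulmxDl ST mul1mx mulmxBr mulmx1.
have comm : (1%:M + S) *m (1%:M - S) = (1%:M - S) *m (1%:M + S).
  rewrite [LHS]mulmxDl mul1mx [S *m (_ - _)]mulmxBr mulmx1.
  by rewrite [RHS]mulmxDr mulmx1 [_ *m S in RHS]mulmxBl mul1mx.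
rewrite /ads_isometry /cayley trmx_mul -!mulmxA (mulmxA _^T ads_J) BT.
rewrite -!mulmxA (mulmxA (1%:M + S)) comm -mulmxA mulmxV // mulmx1 -DT mulmxA.
by rewrite -trmx_mul mulmxV // trmx1 mul1mx.
Qed.

(** Multiplying [ads_J *m cayley A] by the transpose of 1 + A on the left and by 1 + A on the right
    turns it, for an isometry, into the antisymmetric matrix [A^T *m ads_J - ads_J *m A]. *)
Lemma cayley_skew A : \det (1%:M + A) != 0 -> ads_isometry A ->
  (ads_J *m cayley A)^T = - (ads_J *m cayley A).
Proof.
move=> dA iA; have uA : 1%:M + A \in unitmx by rewrite unitmxE unitfE.
have uAT : (1%:M + A)^T \in unitmx by rewrite unitmx_tr.
set K := ads_J *m cayley A.
have KE : (1%:M + A)^T *m K *m (1%:M + A) = A^T *m ads_J - ads_J *m A.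
  rewrite /K /cayley -!mulmxA mulVmx // mulmx1 raddfD /= trmx1.
  rewrite mulmxDl mul1mx mulmxBr mulmx1 mulmxBr (mulmxA _ _ A) iA.
  by rewrite addrC addrA subrK.
move: (1%:M + A) uA uAT KE => D uD uDT KE.
have KTE : D^T *m K^T *m D = (D^T *m K *m D)^T.
  by rewrite !trmx_mul trmxK mulmxA.
have : D^T *m (K^T + K) *m D = 0.
  rewrite mulmxDr mulmxDl KTE KE raddfB /= !trmx_mul trmxK tr_ads_J.
  by rewrite addrA subrK subrr.
move=> /(congr1 (mulmxr (invmx D))) /=; rewrite mulmxK // mul0mx.
move=> /(congr1 (mulmx (invmx D^T))) /=; rewrite mulKmx // mulmx0.
by move/eqP; rewrite addr_eq0 => /eqP.
Qed.

(* The entry (i, j), i < j, is the coordinate of index 'C(j, 2) + i; the last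
   coordinate of v is left for the parameter u. *)
Definition skew_of v : 'M[R]_5 := \matrix_(i, j)
  (if (i < j)%N then v 0 (inord ('C(j, 2) + i))
   else if (j < i)%N then - v 0 (inord ('C(i, 2) + j)) else 0).

(** The two lists give the row and the column of the entry numbered n in the order of [skew_of]. *)
Definition skew_coords K u : 'rV[R]_11 := \row_n
  (if (n < 10)%N then
     K (inord (nth 0%N [:: 0; 0; 1; 0; 1; 2; 0; 1; 2; 3] n))
       (inord (nth 0%N [:: 1; 2; 2; 3; 3; 3; 4; 4; 4; 4] n))
   else u)%N.

Lemma tr_skew v : (skew_of v)^T = - skew_of v.
Proof.
by apply/matrixP => i j; rewrite !mxE; case: ltngtP; rewrite ?opprK ?oppr0.
Qed.

Lemma skewK v : skew_coords (skew_of v) (v 0 ord_max) = v.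
Proof.
apply/matrixP => i n; rewrite ord1 mxE.
by case: n => [[|[|[|[|[|[|[|[|[|[|[|//]]]]]]]]]]] np] /=;
  rewrite ?mxE ?inordK //=; congr (v 0 _); apply: val_inj; rewrite /= ?inordK.
Qed.

Lemma skew_coordsK K u : K^T = - K -> skew_of (skew_coords K u) = K.
Proof.
move=> KT; have KE i j : K j i = - K i j.
  by move/matrixP/(_ i j): KT; rewrite !mxE.
have upper (i j : 'I_5) : (i < j)%N ->
    skew_coords K u 0 (inord ('C(j, 2) + i)) = K i j.
  case: i => [[|[|[|[|[|//]]]]] ip]; case: j => [[|[|[|[|[|//]]]]] jp] //= _;
    by rewrite mxE inordK //=; congr (K _ _); apply: val_inj; rewrite /= inordK.
apply/matrixP => i j; rewrite mxE; case: ltngtP => ij.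
- exact: upper.
- by rewrite upper // -KE.
- have -> : i = j by exact: val_inj.
  have /eqP := KE j j; rewrite -subr_eq0 opprK -mulr2n mulrn_eq0 /=.
  by move/eqP->.
Qed.

Lemma skew_coords_last K u : skew_coords K u 0 ord_max = u.
Proof. by rewrite mxE. Qed.

End Cayley.

(** * The local chart *)

Section NormalVectors.
Context {R : realType}.
Implicit Types (B : 'M[R]_5) (w Z : 'cV[R]_5) (s : R).

(* When B is the reflection in Z, this is the projection of w to the line of Z. *)
Definition axis_vec w B : 'cV[R]_5 := 2^-1 *: (w - B *m w).

(** When [B] is a reflection, this is its normal of norm [s] on the side of [w], written so that it
    depends smoothly on [B] wherever the radicand is positive. *)
Definition normal_vec s w B : 'cV[R]_5 :=
  (Num.sqrt (s * ads_q (axis_vec w B)))^-1 *: axis_vec w B.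

Lemma axis_vec_refl w Z :
  axis_vec w (ads_refl Z) = (ads_b w Z / ads_q Z) *: Z.
Proof.
rewrite /axis_vec ads_refl_mul opprB addrC subrK scalerA.
by rewrite -mulrA mulKf ?pnatr_eq0 // mulrC.
Qed.

Lemma normal_vec_refl s w Z : s ^+ 2 = 1 -> ads_q Z = s ->
  0 < s * ads_b Z w -> normal_vec s w (ads_refl Z) = Z.
Proof.
move=> s2 qZ sw; have s0 : s != 0.
  by apply: contra_eq_neq s2 => ->; rewrite expr0n eq_sym oner_neq0.
rewrite /normal_vec axis_vec_refl qZ ads_qZ qZ ads_bC.
have -> : ads_b Z w / s = s * ads_b Z w.
  by apply: (mulIf s0); rewrite divfK // mulrAC -expr2 s2 mul1r.
have -> : s * ((s * ads_b Z w) ^+ 2 * s) = (s * ads_b Z w) ^+ 2.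
  by rewrite -mulrCA -expr2 s2 mulr1.
by rewrite sqrtr_sqr gtr0_norm // scalerA mulVf ?scale1r // gt_eqF.
Qed.

(* The two unit normals of a reflection are opposite, and the sign condition
   selects the one on the side of w. *)
Lemma refl_normal_vec s w Z : s ^+ 2 = 1 -> unit_normal Z ->
  0 < s * ads_q (axis_vec w (ads_refl Z)) ->
  exists Y, [/\ ads_refl Y = ads_refl Z, ads_q Y = s & 0 < s * ads_b Y w].
Proof.
move=> s2 uZ; rewrite axis_vec_refl ads_qZ => sY.
(* Positivity in [sY] means that [s] and [ads_q Z] have the same sign, and both are 1 or -1. *)
have qZ : ads_q Z = s.
  have /eqP : (s - 1) * (s + 1) = 0 by lra.
  rewrite mulf_eq0 => /orP[] /eqP s1.
    have {s1}s1 : s = 1 by lra.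
    rewrite s1 mul1r in sY *; case: uZ => // qZ; rewrite qZ in sY; nra.
  have {s1}s1 : s = -1 by lra.
  rewrite s1 in sY *; case: uZ => // qZ; rewrite qZ in sY; nra.
have b0 : ads_b Z w != 0.
  apply: contraTneq sY => b0; rewrite ads_bC b0 mul0r expr0n /= mul0r mulr0.
  by rewrite ltxx.
have [sb|sb] := ltP 0 (s * ads_b Z w); first by exists Z.
exists (- Z); rewrite -scaleN1r ads_reflZ ?oppr_eq0 ?oner_eq0 //.
split=> //; first by rewrite ads_qZ sqrrN expr1n mul1r.
rewrite ads_bZl mulN1r mulrN oppr_gt0 lt_neqAle sb andbT mulf_neq0 //.
by apply: contra_eq_neq s2 => ->; rewrite expr0n eq_sym oner_neq0.
Qed.

Lemma gen_sign2 g : (gen_sign g : R) ^+ 2 = 1.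
Proof. by case: g => *; rewrite ?sqrrN expr1n. Qed.

Lemma normal_vec_scale s w B : 0 < s * ads_q (axis_vec w B) ->
  exists2 c, 0 < c & normal_vec s w B = c *: axis_vec w B.
Proof. by move=> q0; eexists; last reflexivity; rewrite invr_gt0 sqrtr_gt0. Qed.

End NormalVectors.

(** * The chart and its inverse as maps *)

Section LocalChart.
Context {R : realType} (t : R).
Hypothesis t1 : -1 < t < 1.

Local Notation matrices := 'M[R]_(#|{: gen}|, 5 * 5).
Implicit Types (x : matrices) (v : 'rV[R]_11) (g h : gen).

Definition gen_mx x g : 'M[R]_5 := vec_mx (row (enum_rank g) x).

Definition of_gens (r : gen -> 'M[R]_5) : matrices :=
  \matrix_(i, j) mxvec (r (enum_val i)) 0 j.

Lemma of_gensK r g : gen_mx (of_gens r) g = r g.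
Proof.
rewrite /gen_mx -[RHS]mxvecK; congr vec_mx; apply/matrixP => i j.
by rewrite !mxE enum_rankK ord1.
Qed.

Lemma gen_mxK x : of_gens (gen_mx x) = x.
Proof. by apply/matrixP => i j; rewrite !mxE vec_mxK mxE enum_valK. Qed.

Lemma on_gensE (rho : Gamma22 -> 'M[R]_5) :
  on_gens rho = of_gens (fun g => rho (gamma g)).
Proof. by []. Qed.

Let f := fvec t.
Let cf : config f. Proof. exact: fvec_config. Qed.
Let nf : nondegenerate_config f. Proof. exact: fvec_nondegenerate. Qed.

Definition gen_axis x g := axis_vec (f g) (gen_mx x g).

Definition gen_normal x g := normal_vec (gen_sign g) (f g) (gen_mx x g).

(* On this open set |b| = 1 determines b, for every asymptotic pair. *)
Definition same_signs : set matrices :=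
  [set x | forall gh : gen * gen, ads_b (f gh.1) (f gh.2) != 0 ->
     0 < ads_b (f gh.1) (f gh.2) * ads_b (gen_axis x gh.1) (gen_axis x gh.2)].

Definition param x : R := parameter (gen_normal x).

(** The target is cut out in stages, so that each function is smooth where it is next used: [param]
    on [same_signs], then [frame_map] on [bounded_param]. *)
Definition bounded_param : set matrices :=
  same_signs `&` param @^-1` [set u | -1 < u < 1].

(** For [x] from [Hom_0] in [same_signs], this is the isometry of [config_transport], which carries
    [fvec (param x)] to the normals of [x]. *)
Definition frame_map x : 'M[R]_5 :=
  transport signs0 (fvec (param x)) (gen_normal x).

(** The determinant condition puts [frame_map x] in the domain of the Cayley transform. *)
Definition target : set matrices :=
  bounded_param `&` (fun x => \det (1%:M + frame_map x)) @^-1` [set a | a != 0].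

Definition inverse_chart x : 'rV[R]_11 :=
  skew_coords (ads_J *m cayley (frame_map x)) (param x).

Definition chart_map v : 'M[R]_5 := cayley (ads_J *m skew_of v).

Definition chart_vec v g : 'cV[R]_5 := chart_map v *m fvec (v 0 ord_max) g.

Definition chart v : matrices := of_gens (fun g => ads_refl (chart_vec v g)).

Definition chart_domain : set 'rV[R]_11 :=
  (fun v => \det (1%:M + ads_J *m skew_of v)) @^-1` [set a | a != 0] `&`
  (fun v => v 0 ord_max) @^-1` [set u | -1 < u < 1].

(** The last condition ensures that [gen_normal] recovers [chart_vec v g] and not its opposite. *)
Definition source : set 'rV[R]_11 :=
  chart_domain `&` chart @^-1` target `&`
  [set v | forall g, 0 < gen_sign g * ads_b (chart_vec v g) (f g)].

Local Notation S := (@on_gens R @` @Hom_0 R).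

Lemma chart_map_isometry v : chart_domain v -> ads_isometry (chart_map v).
Proof. by move=> [dv _]; apply: cayley_isometry; [exact: dv|exact: tr_skew]. Qed.

Lemma chart_config v : chart_domain v -> config (chart_vec v).
Proof.
move=> Dv; apply: ads_isometry_config; first exact: chart_map_isometry.
by apply: fvec_config; case: Dv.
Qed.

Lemma config_of_gens (X : gen -> 'cV[R]_5) : config X ->
  S (of_gens (fun g => ads_refl (X g))).
Proof.
move=> cX; exists (racg_lift (comm := gen_comm) (fun g => ads_refl (X g))).
  exact: config_Hom_0.
rewrite on_gensE; congr of_gens; apply/funext => g; exact: config_gamma.
Qed.

Lemma chart_Hom_0 v : chart_domain v -> S (chart v).
Proof. by move=> Dv; apply: config_of_gens; exact: chart_config. Qed.

Lemma parameter_isometry (A : 'M[R]_5) u : -1 < u < 1 -> ads_isometry A ->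
  parameter (fun g => A *m fvec u g) = u.
Proof.
move=> u1 iA; rewrite /parameter /pm_value !ads_isometry_b // -!/(pm_value _ _ _).
rewrite fvec_pm_value mulfK // lt_eqF //.
by case: (fvec_nondegenerate u1).
Qed.

(** The frame is equivariant under [A], and what remains is the resolution of the identity. This
    reads the isometry back from the normals. *)
Lemma transport_mul (A : 'M[R]_5) e (Y : gen -> 'cV[R]_5) : config Y ->
  transport e Y (fun g => A *m Y g) = A.
Proof.
move=> cY; rewrite /transport.
have -> : frame (fun g => A *m Y g) e = A *m frame Y e.
  by apply/matrixP => i j; rewrite !mxE; apply: eq_bigr => k _; rewrite mxE.
by rewrite -!mulmxA (mulmxA frame_gram_inv) (frame_resolution e cY) mulmx1.
Qed.

Lemma normal_of_gens (X : gen -> 'cV[R]_5) : config X ->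
  (forall g, 0 < gen_sign g * ads_b (X g) (f g)) ->
  gen_normal (of_gens (fun g => ads_refl (X g))) = X.
Proof.
move=> [qX _ _] sX; apply/funext => g; rewrite /gen_normal of_gensK.
by rewrite normal_vec_refl // gen_sign2.
Qed.

(** The normals are recovered first, then the parameter as y / z, then the isometry by
    [transport_mul], and finally its skew coordinates because the Cayley transform is an
    involution. *)
Lemma chartK v : source v -> inverse_chart (chart v) = v.
Proof.
move=> [[Dv _] sv]; have [dv u1] := Dv.
have iA := chart_map_isometry Dv; have cv := chart_config Dv.
have nv := normal_of_gens cv sv.
have pv : param (chart v) = v 0 ord_max.
  by rewrite /param nv parameter_isometry.
have Fv : frame_map (chart v) = chart_map v.
  rewrite /frame_map pv nv transport_mul //; exact: fvec_config.
rewrite /inverse_chart pv Fv /chart_map cayleyK // mulmxA ads_JJ mul1mx.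
exact: skewK.
Qed.

Lemma same_signs_axis x g : same_signs x ->
  0 < gen_sign g * ads_q (gen_axis x g).
Proof.
move=> xP; have := xP (g, g); rewrite /= (config_q cf); apply.
exact: gen_sign_neq0.
Qed.

(** Normalisation multiplies [gen_axis] by a positive factor, which preserves signs of products. *)
Lemma same_signs_normal x g h : same_signs x -> ads_b (f g) (f h) != 0 ->
  0 < ads_b (f g) (f h) * ads_b (gen_normal x g) (gen_normal x h).
Proof.
move=> xP fgh; have [c c0] := normal_vec_scale (same_signs_axis g xP).
have [d d0] := normal_vec_scale (same_signs_axis h xP).
rewrite -!/(gen_normal _ _) -!/(gen_axis _ _) => -> ->; rewrite ads_bZl ads_bZr.
have := xP (g, h) fgh; rewrite /= => b0.
by rewrite mulrCA pmulr_rgt0 // mulrCA pmulr_rgt0.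
Qed.

(** Each inequality concerns a single product that is negative for [fvec t], so its sign persists on
    [same_signs]. *)
Lemma normal_nondegenerate x : same_signs x ->
  nondegenerate_config (gen_normal x).
Proof.
have neg (a b : R) : a < 0 -> (a != 0 -> 0 < a * b) -> b < 0.
  by move=> a0 /(_ (ltr0_neq0 a0)); rewrite nmulr_rgt0.
have [lf pf] := nf => xP; split=> [k|].
  exact: neg (lf k) (same_signs_normal xP).
exact: neg pf (same_signs_normal xP).
Qed.

(** On [same_signs] each reflection has a normal of norm [gen_sign g] on the side of [f g]. Distinct
    commuting reflections make these normals orthogonal, and for asymptotic pairs the sign of the
    product removes the absolute value. *)
Lemma Hom_0_normal x : S x -> same_signs x ->
  [/\ config (gen_normal x), x = of_gens (fun g => ads_refl (gen_normal x g)) &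
      forall g, 0 < gen_sign g * ads_b (gen_normal x g) (f g)].
Proof.
move=> [rho [[[_ _ rM] rg rn] ra] rx] xP.
have gx g : gen_mx x g = rho (gamma g) by rewrite -rx on_gensE of_gensK.
have nP g : [/\ ads_refl (gen_normal x g) = rho (gamma g),
    ads_q (gen_normal x g) = gen_sign g &
    0 < gen_sign g * ads_b (gen_normal x g) (f g)].
  have [Z uZ rZ] := rg g.
  have := same_signs_axis g xP; rewrite /gen_axis gx rZ.
  move=> /(refl_normal_vec (gen_sign2 g) uZ)[Y [rY qY sY]].
  suff -> : gen_normal x g = Y by rewrite rY.
  by rewrite /gen_normal gx rZ -rY normal_vec_refl // gen_sign2.
have un g : unit_normal (gen_normal x g).
  by have [_ qg _] := nP g; exact: gen_sign_normal qg.
split=> [||g]; last by case: (nP g).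
- split=> [g|g h gh|g h gh].
  + by case: (nP g).
  + have [rgE _ _] := nP g; have [rhE _ _] := nP h.
    apply: ads_refl_comm_orth => //; rewrite rgE rhE; last exact: rn.
    by rewrite -!rM gamma_comm.
  + have [rgE _ _] := nP g; have [rhE _ _] := nP h.
    have b1 := ra g h gh _ _ (un g) (un h) (esym rgE) (esym rhE).
    have [_ _ af] := cf; have := same_signs_normal (g := g) (h := h) xP.
    rewrite af // oppr_eq0 => /(_ (gen_sign_neq0 _)).
    move: b1; move: (ads_b (gen_normal x g) (gen_normal x h)) => b.
    by case: ger0P => _ b1; case: (g) => [e|e|k s] /= gb; lra.
- rewrite -[LHS]gen_mxK; congr of_gens; apply/funext => g.
  by rewrite gx; case: (nP g) => ->.
Qed.

(** The Cayley transform of the coordinates gives back [frame_map x], so by [config_transport] the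
    vectors [chart_vec] at the inverse image are exactly the normals of [x]. *)
Lemma inverse_chartK x : S x -> target x ->
  source (inverse_chart x) /\ chart (inverse_chart x) = x.
Proof.
move=> Sx Tx; have [[xP u1] dx] := Tx.
have [cx xE sx] := Hom_0_normal Sx xP.
have nx := normal_nondegenerate xP.
have iA := transport_isometry signs0 cx (fvec_config u1).
rewrite -/(frame_map x) in iA.
have sk : skew_of (inverse_chart x) = ads_J *m cayley (frame_map x).
  by apply: skew_coordsK; apply: cayley_skew.
have JS : ads_J *m skew_of (inverse_chart x) = cayley (frame_map x).
  by rewrite sk mulmxA ads_JJ mul1mx.
have ux : inverse_chart x 0 ord_max = param x by exact: skew_coords_last.
have vx : chart_vec (inverse_chart x) = gen_normal x.
  apply/funext => g; rewrite /chart_vec /chart_map JS cayleyK // ux.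
  by rewrite [RHS](config_transport cx nx).
have chx : chart (inverse_chart x) = x by rewrite /chart vx -xE.
have Tc : target (chart (inverse_chart x)) by rewrite chx.
have dc : \det (1%:M + ads_J *m skew_of (inverse_chart x)) != 0.
  by rewrite JS det_cayley1D.
have uc : -1 < inverse_chart x 0 ord_max < 1 by rewrite ux; exact: u1.
have sc g : 0 < gen_sign g * ads_b (chart_vec (inverse_chart x) g) (f g).
  by rewrite vx.
exact: (conj (conj (conj (conj dc uc) Tc) sc) chx).
Qed.

Lemma base_normal : gen_normal (on_gens (rho_t t)) = f.
Proof.
have -> : on_gens (rho_t t) = of_gens (fun g => ads_refl (f g)).
  rewrite on_gensE; congr of_gens; apply/funext => g; exact: config_gamma.
apply: normal_of_gens => // g; rewrite config_q // -expr2 gen_sign2.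
exact: ltr01.
Qed.

Lemma base_axis g : gen_axis (on_gens (rho_t t)) g = f g.
Proof.
rewrite /gen_axis on_gensE of_gensK [rho_t t _]config_gamma // axis_vec_refl.
rewrite divff ?scale1r //; case: cf => qf _ _.
by rewrite [ads_b _ _]qf gen_sign_neq0.
Qed.

(** At rho_t the axes and normals are [f] itself, the parameter is [t] and [frame_map] is the
    identity, so the determinant is 2^5. *)
Lemma base_target : target (on_gens (rho_t t)).
Proof.
have i1 : ads_isometry (1%:M : 'M[R]_5).
  by rewrite /ads_isometry trmx1 mul1mx mulmx1.
have f1 : f = (fun g => 1%:M *m f g) by apply/funext => g; rewrite mul1mx.
have p1 : param (on_gens (rho_t t)) = t.
  by rewrite /param base_normal f1 parameter_isometry.
split; first split.
- move=> [g h] /= b0; rewrite !base_axis -expr2.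
  by rewrite lt_neqAle sqr_ge0 eq_sym expf_eq0 b0.
- by rewrite /preimage /= p1.
- rewrite /preimage /= /frame_map p1 base_normal f1 transport_mul //.
  by rewrite -mulr2n -scaler_nat detZ det1 mulr1 expf_neq0 // pnatr_eq0.
Qed.

End LocalChart.

(** * Smooth dependence of the geometric constructions *)

Section SmoothConstructions.
Context {R : realType} {V : normedModType R} (U : set V).
Hypothesis oU : open U.

Lemma smooth_ads_b (F G : V -> 'cV[R]_5) : smooth_mx U F -> smooth_mx U G ->
  smooth U (fun x => ads_b (F x) (G x)).
Proof.
move=> CF CG; apply: smooth_sum => // i.
by apply: smoothM => //; apply: smoothM => //; exact: smooth_cst.
Qed.

Lemma smooth_vec5 (x0 x1 x2 x3 x4 : V -> R) : smooth U x0 -> smooth U x1 ->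
  smooth U x2 -> smooth U x3 -> smooth U x4 ->
  smooth_mx U (fun x => vec5 (x0 x) (x1 x) (x2 x) (x3 x) (x4 x)).
Proof.
move=> C0 C1 C2 C3 C4 i j.
case: i => [[|[|[|[|[|//]]]]] ip];
  [move: C0|move: C1|move: C2|move: C3|move: C4];
  by apply: smooth_eq => // x _; rewrite mxE.
Qed.

Lemma smooth_fvec (u : V -> R) g : (forall x, U x -> -1 < u x < 1) ->
  smooth U u -> smooth_mx U (fun x => fvec (u x) g).
Proof.
move=> u1 Cu; have u2 x : U x -> 0 < 1 - u x * u x by move=> /u1; nra.
have Cr : smooth U (fun x => (Num.sqrt (1 - u x ^+ 2))^-1).
  apply: (@smooth_eq _ _ _ _ (fun x => (Num.sqrt (1 - u x * u x))^-1)) => //.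
  apply: smoothV => // [x /u2 ux|]; first by rewrite gt_eqF // sqrtr_gt0.
  apply: smooth_sqrt => //; apply: smoothB => //; first exact: smooth_cst.
  exact: smoothM.
have Cc (c : R) : smooth U (fun=> c) by exact: smooth_cst.
have CM (c : R) : smooth U (fun x => u x * c) by exact: smoothM.
have CM' (c : R) : smooth U (fun x => c * u x) by exact: smoothM.
case: g => [e|e|k s]; last exact: smooth_mx_cst.
- by apply: smooth_mxZ => //; exact: smooth_vec5.
- by apply: smooth_mxZ => //; exact: smooth_vec5.
Qed.

Lemma smooth_ads_refl (F : V -> 'cV[R]_5) :
  (forall x, U x -> ads_q (F x) != 0) -> smooth_mx U F ->
  smooth_mx U (fun x => ads_refl (F x)).
Proof.
move=> F0 CF i j.
apply: (@smooth_eq _ _ _ _ (fun x => (i == j)%:R -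
  2 * (ads_q (F x))^-1 * F x i 0 * (ads_sign R j * F x j 0))) => //.
  by move=> x _; rewrite mxE.
have Cc (c : R) : smooth U (fun=> c) by exact: smooth_cst.
apply: smoothB => //; apply: smoothM => //; last exact: smoothM.
apply: smoothM => //; apply: smoothM => //; apply: smoothV => //.
exact: smooth_ads_b.
Qed.

Lemma smooth_cayley (F : V -> 'M[R]_5) :
  (forall x, U x -> \det (1%:M + F x) != 0) -> smooth_mx U F ->
  smooth_mx U (fun x => cayley (F x)).
Proof.
move=> F0 CF.
have C1 : smooth_mx U (fun=> 1%:M : 'M[R]_5) by exact: smooth_mx_cst.
apply: smooth_mulmx => //; first exact: smooth_mxB.
by apply: smooth_invmx => //; exact: smooth_mxD.
Qed.

Lemma smooth_frame (X : V -> gen -> 'cV[R]_5) e :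
  (forall g, smooth_mx U (X ^~ g)) -> smooth_mx U (fun x => frame (X x) e).
Proof.
move=> CX i j; apply: smooth_eq (CX (frame_gen e j) i 0) => // x _.
by rewrite mxE.
Qed.

Lemma smooth_transport (X Y : V -> gen -> 'cV[R]_5) e :
  (forall g, smooth_mx U (X ^~ g)) -> (forall g, smooth_mx U (Y ^~ g)) ->
  smooth_mx U (fun x => transport e (Y x) (X x)).
Proof.
move=> CX CY; apply: smooth_mulmx; [by []| |exact: smooth_mx_cst].
apply: smooth_mulmx => //; last by apply: smooth_trmx => //; exact: smooth_frame.
by apply: smooth_mulmx => //; [exact: smooth_frame|exact: smooth_mx_cst].
Qed.

Lemma smooth_axis_vec (w : 'cV[R]_5) (F : V -> 'M[R]_5) : smooth_mx U F ->
  smooth_mx U (fun x => axis_vec w (F x)).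
Proof.
move=> CF; apply: smooth_mxZ => //; first exact: smooth_cst.
apply: smooth_mxB => //; first exact: smooth_mx_cst.
by apply: smooth_mulmx => //; exact: smooth_mx_cst.
Qed.

Lemma smooth_normal_vec s (w : 'cV[R]_5) (F : V -> 'M[R]_5) :
  (forall x, U x -> 0 < s * ads_q (axis_vec w (F x))) -> smooth_mx U F ->
  smooth_mx U (fun x => normal_vec s w (F x)).
Proof.
move=> F0 /(smooth_axis_vec w) CF; apply: smooth_mxZ => //.
apply: smoothV => // [x /F0 q0|]; first by rewrite gt_eqF // sqrtr_gt0.
apply: smooth_sqrt => //; apply: smoothM => //; first exact: smooth_cst.
exact: smooth_ads_b.
Qed.

Lemma smooth_skew_coords (F : V -> 'M[R]_5) (u : V -> R) :
  smooth_mx U F -> smooth U u -> smooth_mx U (fun x => skew_coords (F x) (u x)).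
Proof.
move=> CF Cu i n; case: (boolP (n < 10)%N) => n10.
  apply: smooth_eq (CF (inord (nth 0%N [:: 0; 0; 1; 0; 1; 2; 0; 1; 2; 3]%N n))
    (inord (nth 0%N [:: 1; 2; 2; 3; 3; 3; 4; 4; 4; 4]%N n))) => // x _.
  by rewrite mxE n10.
by apply: smooth_eq Cu => // x _; rewrite mxE (negPf n10).
Qed.

Lemma smooth_of_gens (r : V -> gen -> 'M[R]_5) :
  (forall g, smooth_mx U (r ^~ g)) -> smooth_mx U (fun x => of_gens (r x)).
Proof.
move=> Cr i j; case/mxvec_indexP: j => k l.
by apply: smooth_eq (Cr (enum_val i) k l) => // x _; rewrite mxE mxvecE.
Qed.

End SmoothConstructions.

Lemma open_forall (R : realType) (V : normedModType R) (I : finType)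
    (P : I -> set V) :
  (forall i, open (P i)) -> open [set x | forall i, P i x].
Proof.
move=> oP; rewrite openE => x Px; apply: filter_forall => i.
by apply: open_nbhs_nbhs; split.
Qed.

Lemma open_ltrN11 (R : realType) : open [set a : R | -1 < a < 1].
Proof.
rewrite (_ : [set a | _] = [set a : R | -1 < a] `&` [set a : R | a < 1]).
  by apply: openI; [exact: open_gt|exact: open_lt].
by apply/seteqP; split=> [a /andP[]|a /andP].
Qed.

(** * Openness of the domains and smoothness of the charts *)

Section Charts.
Context {R : realType} (t : R).
Hypothesis t1 : -1 < t < 1.
Local Notation matrices := 'M[R]_(#|{: gen}|, 5 * 5).

Lemma smooth_gen_mx (U : set matrices) g : open U ->
  smooth_mx U (fun x => gen_mx x g).
Proof.
move=> oU i j.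
by apply: smooth_eq (smooth_coord (enum_rank g) (mxvec_index i j) oU) => // x _;
  rewrite !mxE.
Qed.

Lemma open_same_signs : open (same_signs t).
Proof.
apply: open_forall => -[g h] /=.
have [b0|b0] := eqVneq (ads_b (fvec t g) (fvec t h)) 0.
  rewrite [X in open X](_ : _ = setT); first exact: openT.
  by apply/seteqP; split.
have oT := @openT matrices.
have Cs : smooth setT (fun x : matrices => ads_b (fvec t g) (fvec t h) *
    ads_b (gen_axis t x g) (gen_axis t x h)).
  apply: smoothM => //; first exact: smooth_cst.
  by apply: smooth_ads_b => //; apply: smooth_axis_vec => //; exact: smooth_gen_mx.
have := open_preimage oT Cs (@open_gt R 0); rewrite setTI.
by congr open; apply/seteqP; split=> x /=; [move=> + _|apply].
Qed.

Lemma smooth_gen_normal (U : set matrices) g : open U -> U `<=` same_signs t ->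
  smooth_mx U (fun x => gen_normal t x g).
Proof.
move=> oU Us; apply: smooth_normal_vec => //; last exact: smooth_gen_mx.
by move=> x /Us; exact: same_signs_axis.
Qed.

Lemma smooth_param (U : set matrices) : open U -> U `<=` same_signs t ->
  smooth U (param t).
Proof.
move=> oU Us; apply: smoothM => //.
  by apply: smooth_ads_b => //; exact: smooth_gen_normal.
apply: smoothV => //.
  by move=> x /Us /(normal_nondegenerate t1)[_]; exact: ltr0_neq0.
by apply: smooth_ads_b => //; exact: smooth_gen_normal.
Qed.

Lemma open_bounded_param : open (bounded_param t).
Proof.
have oS := open_same_signs; apply: open_preimage => //; last exact: open_ltrN11.
exact: smooth_param.
Qed.

Lemma smooth_frame_map (U : set matrices) : open U -> U `<=` bounded_param t ->
  smooth_mx U (frame_map t).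
Proof.
move=> oU Ub; have Us : U `<=` same_signs t by move=> x /Ub[].
apply: smooth_transport => // g; first exact: smooth_gen_normal.
apply: smooth_fvec => //; last exact: smooth_param.
by move=> x /Ub[].
Qed.

Lemma smooth_det1D_frame_map (U : set matrices) : open U ->
  U `<=` bounded_param t -> smooth U (fun x => \det (1%:M + frame_map t x)).
Proof.
move=> oU Ub; apply: smooth_det => //; apply: smooth_mxD => //.
  exact: smooth_mx_cst.
exact: smooth_frame_map.
Qed.

Lemma open_target : open (target t).
Proof.
apply: open_preimage; [exact: open_bounded_param| |exact: open_neq].
by apply: smooth_det1D_frame_map => //; exact: open_bounded_param.
Qed.

Lemma smooth_inverse_chart : smooth (target t) (inverse_chart t).
Proof.
have oT := open_target; have Tb : target t `<=` bounded_param t by move=> x [].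
apply: smooth_mxP => //; apply: smooth_skew_coords => //.
  apply: smooth_mulmx => //; first exact: smooth_mx_cst.
  by apply: smooth_cayley => //; [move=> x []|exact: smooth_frame_map].
by apply: smooth_param => // x /Tb[].
Qed.

Lemma smooth_skew (U : set 'rV[R]_11) : open U ->
  smooth_mx U (fun v => ads_J *m skew_of v).
Proof.
move=> oU; apply: smooth_mulmx => //; first exact: smooth_mx_cst.
move=> i j; have Cv n := @smooth_coord R 1 11 U 0 n oU.
case: (ltngtP i j) => [ij|ij|/val_inj ij].
- by apply: smooth_eq (Cv _) => // v _; rewrite mxE ij.
- by apply: smooth_eq (smoothN oU (Cv _)) => // v _; rewrite mxE ltnNge ltnW // ij.
- by apply: smooth_eq (smooth_cst _ (0 : R)) => // v _; rewrite mxE ij ltnn.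
Qed.

Lemma open_chart_domain : open (@chart_domain R).
Proof.
have oT := @openT 'rV[R]_11.
have C1 : smooth setT (fun v : 'rV[R]_11 => \det (1%:M + ads_J *m skew_of v)).
  apply: smooth_det => //; apply: smooth_mxD => //; first exact: smooth_mx_cst.
  exact: smooth_skew.
have := open_preimage oT C1 (@open_neq R 0).
have := open_preimage oT (smooth_coord 0 ord_max oT) (@open_ltrN11 R).
by rewrite !setTI => o1 o2; exact: openI.
Qed.

Lemma smooth_chart_vec g : smooth_mx (@chart_domain R) (fun v => chart_vec v g).
Proof.
have oD := open_chart_domain; apply: smooth_mulmx => //.
  by apply: smooth_cayley => //; [move=> x []|exact: smooth_skew].
by apply: smooth_fvec => //; [move=> x []|exact: smooth_coord].
Qed.

Lemma smooth_chart : smooth (@chart_domain R) (@chart R).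
Proof.
have oD := open_chart_domain; apply: smooth_mxP => //; apply: smooth_of_gens => // g.
apply: smooth_ads_refl => //; last exact: smooth_chart_vec.
by move=> v /chart_config[-> _ _]; exact: gen_sign_neq0.
Qed.

Lemma open_source : open (source t).
Proof.
have oD := open_chart_domain.
have o1 := open_preimage oD smooth_chart open_target.
(* The domain is moved under the quantifier, since the functions with prescribed sign are shown
   smooth on [chart_domain]. *)
rewrite (_ : source t = [set v | forall g, (chart_domain `&` chart @^-1` target t
  `&` (chart_domain `&` (fun v => gen_sign g *
        ads_b (chart_vec v g) (fvec t g)) @^-1` [set a | 0 < a])) v]).
  apply: open_forall => g; apply: openI => //.
  apply: open_preimage => //.
  apply: smoothM => //; first exact: smooth_cst.
  by apply: smooth_ads_b => //; [exact: smooth_chart_vec|exact: smooth_mx_cst].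
apply/seteqP; split=> v.
  by move=> [[Dv Tv] sv] g; exact: (conj (conj Dv Tv) (conj Dv (sv g))).
(* Any one generator gives back the conditions that do not involve [g]. *)
move=> vP; have [DT _] := vP (gen_l 0 false).
by apply: (conj DT) => g; have [_ [_ sg]] := vP g.
Qed.

End Charts.

Theorem proposition4p11 (R : realType) (t : R) (ht : -1 < t < 1) :
  smooth_manifold_near 11 (@on_gens R @` @Hom_0 R) (on_gens (rho_t t)).
Proof.
split.
  exists (rho_t t) => //; apply: config_Hom_0; exact: fvec_config.
have oT := open_target ht; have oS := open_source ht.
exists (target t); split=> //; first exact: base_target.
(* A single chart serves at every point: [target t] is both the neighbourhood of rho_t and the open
   set around [x], which is why membership in it appears twice below. *)
move=> x [_ Tx]; exists (target t), (source t); split=> //.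
exists (@chart R), (inverse_chart t); split.
- move=> v [[Dv _] _]; exists (@chart_domain R), (@chart R).
  by split=> //; [exact: open_chart_domain|exact: smooth_chart].
- move=> y [_ Ty]; exists (target t), (inverse_chart t).
  by split=> //; exact: smooth_inverse_chart.
- move=> v sv; have [[Dv Tv] _] := sv; rewrite (chartK sv); split=> //.
  by have Sv := chart_Hom_0 Dv; exact: (conj (conj Sv Tv) Tv).
- by move=> y [[Sy Ty] _]; exact: (inverse_chartK ht Sy Ty).
Qed.
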